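(* Assume $\mathcal Z\subset\mathcal N^i(\mathcal T_0)$. Let $0<\varepsilon\le\varepsilon_0:=\min\{2^3(1+C_{REL}^2),\ \max\{2,2^{1/2}(1+C_{REL}^2)^{1/2}\}\,2^3\Lambda_6\}$ and let $\delta_2>0$ be maximal with $$(\ast)\qquad\max\{2^4\Lambda_6^2\delta_2^{2(2-\gamma)},\ 3\times2^6\Lambda_6^2\Lambda_0^2\delta_2^4,\ 2^{13/3}\Lambda_6^{4/3}\Lambda_0^{2/3}\delta_2^{4/3}\}\le\varepsilon .$$ Let $(\bar y_\ell,\bar p_\ell,\bar{\mathbf u}_\ell)$ be the solution of the discrete optimality system with respect to $\mathcal T_\ell\in\mathbb T(\delta_2)$ and $\mathrm d_{\ell,\ell+1}:=\mathrm d(\mathcal T_\ell,\mathcal T_{\ell+1})$. Then there exist $0<\delta\le\delta_2$ satisfying $(\ast)$ (with $\delta$ in place of $\delta_2$) and $0<\Lambda_{4(\varepsilon)}<\infty$ such that for all $\ell,m\in\mathbb N\cup\{0\}$, $$\sum_{k=\ell}^{\ell+m}\mathrm d_{k,k+1}^2\le\Lambda_{4(\varepsilon)}\,\eta_\ell^2+\varepsilon\sum_{k=\ell}^{\ell+m}\eta_k^2 .$$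
   Context: Setting. $\Omega\subset\mathbb R^2$ is a bounded polygonal Lipschitz domain, $V:=H^2_0(\Omega)$, $a(\phi,w):=\int_\Omega D^2\phi:D^2w\,dx$; $\|\cdot\|$ and $(\cdot,\cdot)$ are the $L^2(\Omega)$ norm and inner product. $\mathcal Z\subset\Omega$ is a finite set of $n$ points. Fixed data: $\alpha>0$, $y_d\in L^2(\Omega)$, reals $a_z\le b_z$, $U_{ad}:=\{\mathbf u=\{u_z\}_{z\in\mathcal Z}\in\mathbb R^n: a_z\le u_z\le b_z\ \forall z\}$. $0<\sigma\le1$ is the index of elliptic regularity of the clamped biharmonic problem on $\Omega$ (solutions with right-hand side in $H^{-\gamma}(\Omega)$ lie in $H^{4-\gamma}(\Omega)$ for $2-\sigma\le\gamma\le2$), and $\gamma$ is fixed with $2-\sigma<\gamma\le2$. Continuous solution: $(\bar y,\bar p,\bar{\mathbf u})\in V\times V\times U_{ad}$ with $a(\bar y,\phi)=\sum_z\bar u_z\phi(z)$, $a(\phi,\bar p)=(\bar y-y_d,\phi)$ for all $\phi\in V$, and $\sum_z(\bar p(z)+\alpha\bar u_z)(v_z-\bar u_z)\ge0$ for all $\{v_z\}\in U_{ad}$. Meshes. $(\mathcal T_\ell)_{\ell\ge0}$ is a sequence of uniformly shape-regular triangulations, $\mathcal T_{\ell+1}$ an admissible (newest-vertex bisection) refinement of $\mathcal T_\ell$; $\mathcal N^i(\mathcal T_0)$ is the set of interior vertices of $\mathcal T_0$; $\mathbb T(\delta)$ is the set of shape-regular triangulations with $\max_Th_T\le\delta$,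 $h_T:=|T|^{1/2}$. Discrete solution on $\mathcal T_\ell$: with the Morley space $V_M$ on $\mathcal T_\ell$ (piecewise quadratics, continuous at interior vertices with normal derivative continuous at midpoints of interior edges, vanishing at boundary vertices with normal derivative vanishing at midpoints of boundary edges), $a_{pw}(v,w):=\sum_T\int_TD^2v:D^2w\,dx$, $|||v|||_{pw}:=\|D^2_{pw}v\|$ ($D^m_{pw}$ piecewise derivatives) and the companion operator $J$ (standard conforming smoother $V_M\to V$ preserving vertex values; thus $J\phi_M(z)=\phi_M(z)$ for $z\in\mathcal Z$), $(\bar y_\ell,\bar p_\ell,\bar{\mathbf u}_\ell)\in V_M\times V_M\times U_{ad}$ satisfies $a_{pw}(\bar y_\ell,\phi_M)=\sum_z\bar u_{z,\ell}J\phi_M(z)$, $a_{pw}(\phi_M,\bar p_\ell)=(\bar y_\ell-y_d,\phi_M)$ for all $\phi_M\in V_M$, $\sum_z(J\bar p_\ell(z)+\alpha\bar u_{z,\ell})(w_z-\bar u_{z,\ell})\ge0$ for all $\{w_z\}\in U_{ad}$. Distance: $\mathrm d(\mathcal T_\ell,\mathcal T_{\ell+1})^2:=\|\bar{\mathbf u}_{\ell+1}-\bar{\mathbf u}_\ell\|^2_{\mathbb R^n}+|||\bar y_{\ell+1}-\bar y_\ell|||^2_{pw}+|||\bar p_{\ell+1}-\bar p_\ell|||^2_{pw}$. Estimator on $\mathcal T_\ell$: $\eta_\ell^2:=\sum_{T\in\mathcal T_\ell}\big(h_T^4\|\bar y_\ell-y_d\|^2_{L^2(T)}+\sum_{E\in\mathcal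 E(T)}h_T(\|[D^2_{pw}\bar y_\ell]_E\tau_E\|^2_{L^2(E)}+\|[D^2_{pw}\bar p_\ell]_E\tau_E\|^2_{L^2(E)})\big)$ (the point-source contribution to the volume estimator vanishes since $\mathcal Z\subset\mathcal N^i(\mathcal T_0)$); $\mathcal E(T)$ edges of $T$, $\tau_E$ unit tangent, $[\cdot]_E$ jump (trace on boundary edges). For $\mathcal M\subset\mathcal T_\ell$, $\mu_\ell(\mathcal M)^2:=\sum_{T\in\mathcal M}h_T^4\|\bar y_\ell-y_d\|^2_{L^2(T)}$. Constants. $e_\ell^2:=\|\bar{\mathbf u}-\bar{\mathbf u}_\ell\|^2_{\mathbb R^n}+|||\bar y-\bar y_\ell|||^2_{pw}+|||\bar p-\bar p_\ell|||^2_{pw}$, $\mathrm{osc}_\ell:=\|h_{\mathcal T_\ell}^2(1-\Pi_{2,\mathcal T_\ell})(\bar y_\ell-y_d)\|$ ($h_{\mathcal T_\ell}|_T:=h_T$, $\Pi_{2,\mathcal T_\ell}$ the $L^2$ projection onto piecewise quadratics), $\widehat e_\ell:=e_\ell+\mathrm{osc}_\ell$. $C_{REL}$ is the reliability constant: $e_\ell^2\le C_{REL}^2\eta_\ell^2$. $\Lambda_0:=C_{PI}$ is the constant in $\|w\|+\|w\|_{L^\infty(\Omega)}+\|D_{pw}w\|\le C_{PI}|||w|||_{pw}$ for all $w\in V_M+\widehat V_M$ (Morley spaces on a mesh and a refinement). $C_c,C_s,C_a$ are the mesh-independent constants such that for meshes in $\mathbb T(\delta)$: $(\bar{\mathbf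 u}_{k+1}-\bar{\mathbf u}_k,\bar{\mathbf u}_{k+1}-\bar{\mathbf u})\le C_c\delta^{2-\gamma}|||\bar p_{k+1}-\bar p_k|||_{pw}\widehat e_{k+1}$, $a_{pw}(\bar y_{k+1}-\bar y_k,\bar y_{k+1}-\bar y)\le C_s\delta^{2-\gamma}|||\bar p_{k+1}-\bar p_k|||_{pw}\widehat e_{k+1}$, $a_{pw}(\bar p_{k+1}-\bar p_k,\bar p_{k+1}-\bar p)\le C_a(\mu_k(\mathcal T_k\setminus\mathcal T_{k+1})+\delta^{2-\gamma}|||\bar y_{k+1}-\bar y_k|||_{pw})\widehat e_{k+1}$. Finally $C_{sa}:=2^{3/2}\max\{C_c,C_s,C_a\}$ and $\Lambda_6^2:=C_{sa}^2(1+C_{REL}^2)$. *)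

(* Defs.v *)
From HB Require Import structures.
From mathcomp Require Import all_boot all_order all_algebra.
From mathcomp Require Import all_classical all_reals all_analysis.

Set Implicit Arguments.
Unset Strict Implicit.
Unset Printing Implicit Defensive.

Import Order.TTheory GRing.Theory Num.Theory.
Import numFieldNormedType.Exports.

Local Open Scope classical_set_scope.
Local Open Scope ring_scope.

Notation pt R := (R * R)%type (only parsing).

Definition coord (R : realType) (x : pt R) (i : bool) : R :=
  if i then x.2 else x.1.

Definition dir (R : realType) (i : bool) : pt R :=
  if i then (0, 1) else (1, 0).

Definition dot (R : realType) (x y : pt R) : R := x.1 * y.1 + x.2 * y.2.

Definition rot (R : realType) (x : pt R) : pt R := (- x.2, x.1).

Definition elen (R : realType) (E : pt R * pt R) : R :=
  Num.sqrt (dot (E.2 - E.1) (E.2 - E.1)).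

Definition mid (R : realType) (E : pt R * pt R) : pt R :=
  2^-1 *: (E.1 + E.2).

Definition tangent (R : realType) (E : pt R * pt R) : pt R :=
  (elen E)^-1 *: (E.2 - E.1).

Definition hull (R : realType) (s : seq (pt R)) : set (pt R) :=
  [set x | exists w : 'I_(size s) -> R,
    [/\ forall i, 0 <= w i, \sum_i w i = 1 & x = \sum_i w i *: s`_i]].

(* The plane with its Borel sigma-algebra; L2 functions are represented by
   Borel measurable ones. *)
Notation mpt R := (measurableTypeR R * measurableTypeR R)%type (only parsing).

Definition lebesgue2 (R : realType) : {measure set (mpt R) -> \bar R} :=
  ((@lebesgue_measure R) \x (@lebesgue_measure R))%E.
Arguments lebesgue2 : clear implicits.

Definition domain (R : realType) (Om : set (pt R)) : Prop :=
  [/\ open Om, connected Om, Om !=set0 & bounded_set Om].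

Definition boundary (R : realType) (Om : set (pt R)) : set (pt R) :=
  closure Om `\` Om^°.

Definition polygonal (R : realType) (Om : set (pt R)) : Prop :=
  exists s : seq (pt R * pt R),
    boundary Om = \bigcup_(E in [set` s]) hull [:: E.1; E.2].

(* Near every boundary point, and in a suitable orthonormal frame
   (t, rot t), Om is the strict epigraph of a Lipschitz function. *)
Definition lipschitz_boundary (R : realType) (Om : set (pt R)) : Prop :=
  forall p : pt R, boundary Om p ->
  exists (t : pt R) (g : R -> R) (L : R),
    [/\ dot t t = 1,
        forall s s', `|g s - g s'| <= L * `|s - s'|
      & \forall x \near p, Om x <-> g (dot x t) < dot x (rot t)].

Definition polygonal_lipschitz_domain (R : realType) (Om : set (pt R)) : Prop :=
  [/\ domain Om, polygonal Om & lipschitz_boundary Om].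

(* A jet is a function together with its (classical, weak or piecewise)
   partial derivatives, indexed by words in the directions
   false = x.1 and true = x.2; the empty word gives the function itself. *)
Notation jet R := (seq bool -> pt R -> R).

Definition iterD (R : realType) (f : pt R -> R) : jet R :=
  fun s => foldr (fun i (g : pt R -> R) x => 'D_(dir R i) g x) f s.

Definition L2 (R : realType) (Om : set (pt R)) (f : pt R -> R) : Prop :=
  measurable_fun (Om : set (mpt R)) (f : mpt R -> R) /\
  (lebesgue2 R).-integrable Om (fun x => (f x ^+ 2)%:E).

Definition L2ip (R : realType) (Om : set (pt R)) (f g : pt R -> R) : R :=
  \int[lebesgue2 R]_(x in Om) (f x * g x).

Definition L2norm (R : realType) (Om : set (pt R)) (f : pt R -> R) : R :=
  Num.sqrt (\int[lebesgue2 R]_(x in Om) (f x ^+ 2)).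

Definition Linfnorm (R : realType) (Om : set (pt R)) (f : pt R -> R) : \bar R :=
  'N[lebesgue2 R]_+oo[(fun x => (\1_Om x * f x)%:E)]%E.

(* The L2 inner product and norm of the m-th derivative tensors. For m = 2
   the integrand is the Frobenius product of the Hessians. *)
Definition Dip (R : realType) (m : nat) (Om : set (pt R)) (v w : jet R) : R :=
  \sum_(s : m.-tuple bool) L2ip Om (v s) (w s).

Definition Dnorm (R : realType) (m : nat) (Om : set (pt R)) (v : jet R) : R :=
  Num.sqrt (Dip m Om v v).

Definition smooth (R : realType) (f : pt R -> R) : Prop :=
  forall s, continuous (iterD f s) /\
    forall i x, derivable (iterD f s) x (dir R i).

(* C_c^oo(Om), extended by zero *)
Definition test_fun (R : realType) (Om : set (pt R)) (f : pt R -> R) : Prop :=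
  smooth f /\
  exists A : set (pt R),
    [/\ compact A, A `<=` Om & forall x, ~ A x -> f x = 0].

(* V = H^2_0(Om), the closure of C_c^oo(Om) in H^2(Om). An element is
   represented by its continuous representative v [::] on the plane (which
   vanishes off Om) together with its weak derivatives of order 1 and 2.
   The entries of v of order > 2 carry no information. *)
Definition H20 (R : realType) (Om : set (pt R)) (v : jet R) : Prop :=
  [/\ continuous (v [::]),
      forall x, ~ Om x -> v [::] x = 0,
      forall s, (size s <= 2)%N -> L2 Om (v s)
    & exists2 phi : nat -> pt R -> R,
        forall k, test_fun Om (phi k)
      & forall s, (size s <= 2)%N ->
          L2norm Om (iterD (phi k) s - v s) @[k --> \oo] --> (0 : R)].

Definition weak_jet (R : realType) (Om : set (pt R)) (k : nat) (v : jet R) :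
    Prop :=
  forall s, (size s <= k)%N -> L2 Om (v s) /\
    forall phi, test_fun Om phi ->
      L2ip Om (v [::]) (iterD phi s) = (-1) ^+ size s * L2ip Om (v s) phi.

(* squared Gagliardo seminorm of order 0 < t < 1 in dimension 2 *)
Definition gagliardo2 (R : realType) (Om : set (pt R)) (t : R) (f : pt R -> R) :
    \bar R :=
  (\int[lebesgue2 R]_(x in Om) \int[lebesgue2 R]_(y in Om)
     ((f x - f y) ^+ 2 / (dot (x - y) (x - y)) `^ (1 + t))%:E)%E.

(* squared Sobolev-Slobodeckij norm of (possibly fractional) order r >= 0 *)
Definition sobolev_norm2 (R : realType) (Om : set (pt R)) (r : R) (v : jet R) :
    \bar R :=
  let k := Num.truncn r in
  let t := r - k%:R in
  (\sum_(m < k.+1) \sum_(s : m.-tuple bool)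
      \int[lebesgue2 R]_(x in Om) (v s x ^+ 2)%:E
   + (if (t == 0)%R then 0 else \sum_(s : k.-tuple bool) gagliardo2 Om t (v s)))%E.

Definition sobolev (R : realType) (Om : set (pt R)) (r : R) (f : pt R -> R) :
    Prop :=
  exists v : jet R,
    [/\ forall x, Om x -> v [::] x = f x,
        weak_jet Om (Num.truncn r) v
      & (sobolev_norm2 Om r v < +oo)%E].

(* H^{-r}(Om) is the dual of H^r_0(Om), i.e. the linear functionals on
   C_c^oo(Om) that are bounded for the H^r norm. *)
Definition dual_sobolev (R : realType) (Om : set (pt R)) (r : R)
    (F : (pt R -> R) -> R) : Prop :=
  (forall a phi psi, test_fun Om phi -> test_fun Om psi ->
     F (fun x => a * phi x + psi x) = a * F phi + F psi) /\
  exists C : R, forall phi, test_fun Om phi ->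
    (((F phi) ^+ 2)%:E <= C%:E * sobolev_norm2 Om r (iterD phi))%E.

(* For u in H^2_0(Om) and F in H^{-r}(Om) with r <= 2 it suffices, by
   density, to test the biharmonic equation with C_c^oo(Om). *)
Definition elliptic_regularity (R : realType) (Om : set (pt R)) (sigma : R) :
    Prop :=
  forall r : R, 2 - sigma <= r -> r <= 2 ->
  forall (F : (pt R -> R) -> R) (u : jet R),
    dual_sobolev Om r F -> H20 Om u ->
    (forall phi, test_fun Om phi -> Dip 2 Om u (iterD phi) = F phi) ->
    sobolev Om (4 - r) (u [::]).

(* A triangle (a, b, c) has newest vertex c and refinement edge ab. *)
Notation tri R := (pt R * pt R * pt R)%type (only parsing).

Definition verts (R : realType) (K : tri R) : seq (pt R) :=
  [:: K.1.1; K.1.2; K.2].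

Definition edges (R : realType) (K : tri R) : seq (pt R * pt R) :=
  [:: (K.1.1, K.1.2); (K.1.2, K.2); (K.2, K.1.1)].

Definition has_edge (R : realType) (K : tri R) (E : pt R * pt R) : bool :=
  (E \in edges K) || ((E.2, E.1) \in edges K).

(* open triangle: norms in L2(T) are taken over the interior of T *)
Definition otri (R : realType) (K : tri R) : set (pt R) :=
  [set x | exists w : 'I_3 -> R,
    [/\ forall i, 0 < w i, \sum_i w i = 1 & x = \sum_i w i *: (verts K)`_i]].

Definition area (R : realType) (K : tri R) : R :=
  `|dot (K.1.2 - K.1.1) (rot (K.2 - K.1.1))| / 2.

Definition hT (R : realType) (K : tri R) : R := Num.sqrt (area K).

(* regular triangulation in the sense of Ciarlet: two distinct triangles
   are disjoint or share exactly one vertex or one edge *)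
Definition triangulation (R : realType) (Om : set (pt R)) (T : seq (tri R)) :
    Prop :=
  [/\ uniq T,
      forall K, K \in T -> 0 < area K,
      closure Om = \bigcup_(K in [set` T]) hull (verts K)
    & forall K K', K \in T -> K' \in T -> K != K' ->
        let common := [seq z <- verts K | z \in verts K'] in
        (size common < 3)%N /\
        hull (verts K) `&` hull (verts K') = hull common].

Definition shape_regular (R : realType) (kappa : R) (T : seq (tri R)) : Prop :=
  forall K, K \in T -> forall E, E \in edges K -> elen E ^+ 2 <= kappa * area K.

Definition TT (R : realType) (Om : set (pt R)) (kappa delta : R)
    (T : seq (tri R)) : Prop :=
  [/\ triangulation Om T, shape_regular kappa T
    & forall K, K \in T -> hT K <= delta].

Definition interior_vertex (R : realType) (Om : set (pt R)) (T : seq (tri R))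
    (z : pt R) : Prop :=
  Om z /\ exists2 K, K \in T & z \in verts K.

(* nvb K s : s results from K by finitely many newest-vertex bisections *)
Inductive nvb (R : realType) : tri R -> seq (tri R) -> Prop :=
| nvb_leaf K : nvb K [:: K]
| nvb_bisect a b c s1 s2 :
    nvb (c, a, mid (a, b)) s1 -> nvb (b, c, mid (a, b)) s2 ->
    nvb (a, b, c) (s1 ++ s2).

Definition refinement (R : realType) (T T' : seq (tri R)) : Prop :=
  exists2 f : tri R -> seq (tri R),
    forall K, K \in T -> nvb K (f K)
  & perm_eq T' (flatten [seq f K | K <- T]).

Definition quadratic (R : realType) (p : pt R -> R) : Prop :=
  exists c0 c1 c2 c3 c4 c5 : R, forall x,
    p x = c0 + c1 * x.1 + c2 * x.2
          + c3 * x.1 ^+ 2 + c4 * (x.1 * x.2) + c5 * x.2 ^+ 2.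

(* A piecewise polynomial assigns a polynomial to every triangle. *)
Notation pwfun R := (tri R -> pt R -> R).

(* The sum runs over the (at most one) neighbour of K across E; it is empty
   for boundary edges, where the jump is the trace. *)
Definition jump (R : realType) (T : seq (tri R)) (v : pwfun R) (K : tri R)
    (E : pt R * pt R) (x : pt R) : R :=
  v K x - \sum_(K' <- T | (K' != K) && has_edge K' E) v K' x.

Definition morley (R : realType) (Om : set (pt R)) (T : seq (tri R))
    (v : pwfun R) : Prop :=
  [/\ forall K, K \in T -> quadratic (v K),
      forall K K' z, K \in T -> K' \in T -> z \in verts K -> z \in verts K' ->
        Om z -> v K z = v K' z,
      forall K z, K \in T -> z \in verts K -> ~ Om z -> v K z = 0
    & forall K E, K \in T -> E \in edges K ->
        jump T (fun K' x => 'D_(rot (tangent E)) (v K') x) K E (mid E) = 0].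

(* piecewise derivatives, set to 0 on the (null) skeleton of T *)
Definition pw (R : realType) (T : seq (tri R)) (v : pwfun R) : jet R :=
  fun s x => \sum_(K <- T) \1_(otri K) x * iterD (v K) s x.

Definition companion (R : realType) (Om : set (pt R)) (T : seq (tri R))
    (J : pwfun R -> jet R) : Prop :=
  [/\ forall v, morley Om T v -> H20 Om (J v),
      forall a v w x, morley Om T v -> morley Om T w ->
        J (fun K y => a * v K y + w K y) [::] x
        = a * J v [::] x + J w [::] x
    & forall v K z, morley Om T v -> K \in T -> z \in verts K ->
        J v [::] z = v K z].

Record ocp (R : realType) (n : nat) := OCP {
  Omega : set (pt R);
  Zpt : 'I_n -> pt R;
  alpha : R;
  yd : pt R -> R;
  lo : 'I_n -> R;
  up : 'I_n -> R }.

Definition ocp_ok (R : realType) (n : nat) (P : ocp R n) : Prop :=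
  [/\ polygonal_lipschitz_domain (Omega P),
      injective (Zpt P) /\ (forall z, Omega P (Zpt P z)),
      0 < alpha P,
      L2 (Omega P) (yd P)
    & forall z, lo P z <= up P z].

Definition Uad (R : realType) (n : nat) (P : ocp R n) (u : 'I_n -> R) : Prop :=
  forall z, lo P z <= u z <= up P z.

Record sol (R : realType) (n : nat) (X : Type) := Sol {
  state : X;
  costate : X;
  ctrl : 'I_n -> R }.

Definition continuous_solution (R : realType) (n : nat) (P : ocp R n)
    (s : sol R n (jet R)) : Prop :=
  let Om := Omega P in
  [/\ [/\ H20 Om (state s), H20 Om (costate s) & Uad P (ctrl s)],
      forall phi, H20 Om phi ->
        Dip 2 Om (state s) phi = \sum_z ctrl s z * phi [::] (Zpt P z),
      forall phi, H20 Om phi ->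
        Dip 2 Om phi (costate s)
        = L2ip Om (fun x => state s [::] x - yd P x) (phi [::])
    & forall v, Uad P v ->
        0 <= \sum_z (costate s [::] (Zpt P z) + alpha P * ctrl s z)
                    * (v z - ctrl s z)].

Definition discrete_solution (R : realType) (n : nat) (P : ocp R n)
    (T : seq (tri R)) (J : pwfun R -> jet R) (s : sol R n (pwfun R)) : Prop :=
  let Om := Omega P in
  [/\ [/\ morley Om T (state s), morley Om T (costate s) & Uad P (ctrl s)],
      forall phi, morley Om T phi ->
        Dip 2 Om (pw T (state s)) (pw T phi)
        = \sum_z ctrl s z * J phi [::] (Zpt P z),
      forall phi, morley Om T phi ->
        Dip 2 Om (pw T phi) (pw T (costate s))
        = L2ip Om (fun x => pw T (state s) [::] x - yd P x) (pw T phi [::])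
    & forall w, Uad P w ->
        0 <= \sum_z (J (costate s) [::] (Zpt P z) + alpha P * ctrl s z)
                    * (w z - ctrl s z)].

(* All differences of discrete solutions on different meshes, and their
   differences with continuous ones, are taken between jets on Omega. *)
Definition pwsol (R : realType) (n : nat) (T : seq (tri R))
    (s : sol R n (pwfun R)) : sol R n (jet R) :=
  Sol (pw T (state s)) (pw T (costate s)) (ctrl s).

Definition dist2 (R : realType) (n : nat) (P : ocp R n) (s s' : sol R n (jet R)) :
    R :=
  \sum_z (ctrl s' z - ctrl s z) ^+ 2
  + Dnorm 2 (Omega P) (state s' - state s) ^+ 2
  + Dnorm 2 (Omega P) (costate s' - costate s) ^+ 2.

Definition vol2 (R : realType) (n : nat) (P : ocp R n) (M : seq (tri R))
    (s : sol R n (pwfun R)) : R :=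
  \sum_(K <- M) hT K ^+ 4
    * L2norm (otri K) (fun x => state s K x - yd P x) ^+ 2.

Definition edge_int (R : realType) (E : pt R * pt R) (f : pt R -> R) : R :=
  elen E * \int[@lebesgue_measure R]_(t in `[0, 1]) f (E.1 + t *: (E.2 - E.1)).

(* squared L2(E) norm of the vector field [D^2_pw v]_E tangent E *)
Definition jump_hess2 (R : realType) (T : seq (tri R)) (v : pwfun R)
    (K : tri R) (E : pt R * pt R) : R :=
  edge_int E (fun x => \sum_(i : bool)
    (\sum_(j : bool) jump T (fun K' => iterD (v K') [:: i; j]) K E x
                     * coord (tangent E) j) ^+ 2).

Definition eta2 (R : realType) (n : nat) (P : ocp R n) (T : seq (tri R))
    (s : sol R n (pwfun R)) : R :=
  \sum_(K <- T)
    (hT K ^+ 4 * L2norm (otri K) (fun x => state s K x - yd P x) ^+ 2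
     + \sum_(E <- edges K)
         hT K * (jump_hess2 T (state s) K E + jump_hess2 T (costate s) K E)).

(* L2(K)-orthogonal projection onto quadratic polynomials; it exists for
   every f in L2(K), so that the default value 0 is never used *)
Definition proj2 (R : realType) (K : tri R) (f : pt R -> R) : pt R -> R :=
  xget (fun=> 0) [set p | quadratic p /\ forall q, quadratic q ->
    L2ip (otri K) (fun x => f x - p x) q = 0].

Definition osc (R : realType) (n : nat) (P : ocp R n) (T : seq (tri R))
    (s : sol R n (pwfun R)) : R :=
  Num.sqrt (\sum_(K <- T) L2norm (otri K) (fun x =>
    hT K ^+ 2 * ((state s K x - yd P x)
                 - proj2 K (fun y => state s K y - yd P y) x)) ^+ 2).

Definition err2 (R : realType) (n : nat) (P : ocp R n) (sbar : sol R n (jet R))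
    (T : seq (tri R)) (s : sol R n (pwfun R)) : R :=
  dist2 P (pwsol T s) sbar.

Definition ehat (R : realType) (n : nat) (P : ocp R n) (sbar : sol R n (jet R))
    (T : seq (tri R)) (s : sol R n (pwfun R)) : R :=
  Num.sqrt (err2 P sbar T s) + osc P T s.

Definition solved (R : realType) (n : nat) (P : ocp R n) (kappa delta : R)
    (T : seq (tri R)) (s : sol R n (pwfun R)) : Prop :=
  [/\ TT (Omega P) kappa delta T,
      forall z, interior_vertex (Omega P) T (Zpt P z)
    & exists2 J, companion (Omega P) T J & discrete_solution P T J s].

Definition reliability (R : realType) (n : nat) (P : ocp R n) (kappa : R)
    (sbar : sol R n (jet R)) (CREL : R) : Prop :=
  forall delta T s, solved P kappa delta T s ->
    err2 P sbar T s <= CREL ^+ 2 * eta2 P T s.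

Definition discrete_embedding (R : realType) (Om : set (pt R)) (kappa CPI : R) :
    Prop :=
  forall delta T T' v v',
    TT Om kappa delta T -> TT Om kappa delta T' -> refinement T T' ->
    morley Om T v -> morley Om T' v' ->
    let w := pw T v + pw T' v' in
    ((L2norm Om (w [::]))%:E + Linfnorm Om (w [::]) + (Dnorm 1 Om w)%:E
     <= (CPI * Dnorm 2 Om w)%:E)%E.

Definition solved_pair (R : realType) (n : nat) (P : ocp R n) (kappa delta : R)
    (T T' : seq (tri R)) (s s' : sol R n (pwfun R)) : Prop :=
  [/\ solved P kappa delta T s, solved P kappa delta T' s' & refinement T T'].

Definition control_bound (R : realType) (n : nat) (P : ocp R n)
    (kappa gamma : R) (sbar : sol R n (jet R)) (Cc : R) : Prop :=
  forall delta T T' s s', 0 < delta -> solved_pair P kappa delta T T' s s' ->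
    \sum_z (ctrl s' z - ctrl s z) * (ctrl s' z - ctrl sbar z)
    <= Cc * delta `^ (2 - gamma)
       * Dnorm 2 (Omega P) (pw T' (costate s') - pw T (costate s))
       * ehat P sbar T' s'.

Definition state_bound (R : realType) (n : nat) (P : ocp R n)
    (kappa gamma : R) (sbar : sol R n (jet R)) (Cs : R) : Prop :=
  forall delta T T' s s', 0 < delta -> solved_pair P kappa delta T T' s s' ->
    Dip 2 (Omega P) (pw T' (state s') - pw T (state s))
                    (pw T' (state s') - state sbar)
    <= Cs * delta `^ (2 - gamma)
       * Dnorm 2 (Omega P) (pw T' (costate s') - pw T (costate s))
       * ehat P sbar T' s'.

Definition costate_bound (R : realType) (n : nat) (P : ocp R n)
    (kappa gamma : R) (sbar : sol R n (jet R)) (Ca : R) : Prop :=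
  forall delta T T' s s', 0 < delta -> solved_pair P kappa delta T T' s s' ->
    Dip 2 (Omega P) (pw T' (costate s') - pw T (costate s))
                    (pw T' (costate s') - costate sbar)
    <= Ca * (Num.sqrt (vol2 P [seq K <- T | K \notin T'] s)
             + delta `^ (2 - gamma)
               * Dnorm 2 (Omega P) (pw T' (state s') - pw T (state s)))
       * ehat P sbar T' s'.

Definition Csa (R : realType) (Cc Cs Ca : R) : R :=
  2 `^ (3 / 2) * Num.max Cc (Num.max Cs Ca).

Definition Lambda6 (R : realType) (CREL Cc Cs Ca : R) : R :=
  Num.sqrt (Csa Cc Cs Ca ^+ 2 * (1 + CREL ^+ 2)).

Definition eps0 (R : realType) (CREL L6 : R) : R :=
  Num.min (2 ^+ 3 * (1 + CREL ^+ 2))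
    (Num.max 2 (2 `^ (1 / 2) * (1 + CREL ^+ 2) `^ (1 / 2)) * 2 ^+ 3 * L6).

Definition meshsize_cond (R : realType) (gamma L0 L6 eps delta : R) : Prop :=
  Num.max (2 ^+ 4 * L6 ^+ 2 * delta `^ (2 * (2 - gamma)))
    (Num.max (3 * 2 ^+ 6 * L6 ^+ 2 * L0 ^+ 2 * delta ^+ 4)
       (2 `^ (13 / 3) * L6 `^ (4 / 3) * L0 `^ (2 / 3) * delta `^ (4 / 3)))
  <= eps.

(* Main.v *)
Require Import Defs.
From HB Require Import structures.
From mathcomp Require Import all_boot all_order all_algebra.
From mathcomp Require Import all_classical all_reals all_analysis.
From mathcomp Require Import measurable_realfun ring lra.

Set Implicit Arguments.
Unset Strict Implicit.
Unset Printing Implicit Defensive.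

Import Order.TTheory GRing.Theory Num.Theory.
Import numFieldNormedType.Exports.

Local Open Scope classical_set_scope.
Local Open Scope ring_scope.

(** Notation of this comment: on level k, E is the squared error [err2], m the
    volume term [vol2], r the part of m that lives on the triangles bisected
    on the way to level k+1, o the oscillation [osc], H the estimator [eta2]
    and d the squared distance to level k+1; P and Y are the energy norms of
    the increments of costate and state, and primes mark level k+1. Further
    R = CREL, S = 1 + R^2, C = max(Cc, Cs, Ca), L = Lambda6^2 = 8 C^2 S and
    D = delta2^(2 - gamma).

    Polarising the three inner products ([dist2_polar]) and inserting the
    three given bounds yields
      d <= E - E' + 2 C (D (2P + Y) + sqrt r) (sqrt E' + o').
    The difference E - E' telescopes; the product has to be absorbed. The
    estimator of the last level l+m+1 is absent from the right-hand side of
    the claim, so that step k may only be charged to H, never to H'. Three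
    facts make this possible.
    - E' can be absorbed by -E' itself: Young's inequality charges it the
      factor eps / (8 S), which is at most 1 because eps <= eps0.
    - o' <= o. The discrete state is piecewise quadratic, so the projection
      error of the residual only depends on yd, and refinement can only
      decrease it ([osc_refine]). Moreover o^2 <= m <= H.
    - r is a decrease of m. A bisection divides h_T^4 by 4, hence
        m' <= (1 + lam) (m - 3/4 r) + (1 + 1/lam) CPI^2 delta2^4 Y^2
      for every lam > 0, the last term being the effect of replacing the
      state of level k by that of level k+1 ([vol2_refine]).

    Young's inequality with the weights eps / (8 S) for E' and eps / (4 S) for
    o'^2 leaves (12 S / eps) C^2 (D (2P + Y) + sqrt r)^2. By the mesh-size
    condition this is at most 3/32 (2P + Y + 4x)^2 with x^2 = r L / eps, a
    quadratic form in (P, Y, x) that is small enough to be dominated by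
    13/20 d and by the decrease of (10 L / eps) m, for lam = eps^2 / (100 L)
    ([step_bound]). Therefore the potential
      Phi = (1 - eps / (8 S)) E + (10 L / eps) m
    satisfies 7/20 d <= Phi - Phi' + 7/20 eps H ([potential_step]), where
    7/20 = 1 - 13/20 on the left, and 7/20 = 1/4 + 1/10 on the right, for the
    Young weights and for lam. Since 0 <= Phi <= (R^2 + 10 L / eps) H,
    summation proves the claim with delta = delta2 ([potential_sum]).

    The remaining work is to justify these manipulations for the integrals
    involved: all functions are square integrable on Omega and on the open
    triangles, the open triangles of a triangulation are disjoint subsets of
    Omega, and the projections onto the quadratic polynomials exist. *)

(** * Square integrable functions *)

Section L2_theory.
Variable R : realType.
Implicit Types (A B : set (mpt R)) (f g h : pt R -> R).

Local Notation mu := (lebesgue2 R).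

Lemma L2_integrableM A f g : measurable A -> L2 A f -> L2 A g ->
  mu.-integrable A (EFin \o (fun x => f x * g x)).
Proof.
move=> mA [mf f2] [mg g2].
have mfg : measurable_fun A ((fun x => f x * g x) : mpt R -> R).
  exact: measurable_funM.
apply: (@le_integrable _ _ _ mu A mA _ (fun x => (f x ^+ 2)%:E + (g x ^+ 2)%:E)%E).
- exact/measurable_EFinP.
- move=> x _ /=; rewrite lee_fin normrM [leRHS]ger0_norm ?addr_ge0 ?sqr_ge0//.
  by rewrite -(real_normK (num_real (f x))) -(real_normK (num_real (g x))); nra.
- exact: integrableD.
Qed.

Lemma L2D A f g : measurable A -> L2 A f -> L2 A g ->
  L2 A (fun x => f x + g x).
Proof.
move=> mA Lf Lg; have [mf f2] := Lf; have [mg g2] := Lg; split.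
  exact: measurable_funD.
apply: (eq_integrable mA (fun x => (f x ^+ 2)%:E + (2%:E * (f x * g x)%:E
    + (g x ^+ 2)%:E))%E).
  by move=> x _; rewrite -EFinM -!EFinD; congr EFin; ring.
apply: integrableD => //; apply: integrableD => //; apply: integrableZl => //.
exact: L2_integrableM.
Qed.

Lemma L2Z A (c : R) f : measurable A -> L2 A f -> L2 A (fun x => c * f x).
Proof.
move=> mA [mf f2]; split; first by apply: measurable_funM.
apply: (eq_integrable mA (fun x => (c ^+ 2)%:E * (f x ^+ 2)%:E)%E).
  by move=> x _; rewrite -EFinM exprMn.
exact: integrableZl.
Qed.

Lemma L2B A f g : measurable A -> L2 A f -> L2 A g ->
  L2 A (fun x => f x - g x).
Proof.
move=> mA Lf Lg; have := L2D mA Lf (L2Z (-1) mA Lg).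
by congr L2; apply: funext => x; ring.
Qed.

Lemma L2S A B f : measurable A -> measurable B -> A `<=` B -> L2 B f -> L2 A f.
Proof.
move=> mA mB AB [mf f2]; split; first exact: measurable_funS mf.
exact: integrableS f2.
Qed.

Lemma eq_L2 A f g : measurable A -> (forall x, A x -> f x = g x) ->
  L2 A f -> L2 A g.
Proof.
move=> mA fg [mf f2]; split.
  by apply: eq_measurable_fun mf => x /set_mem; exact: fg.
by apply: eq_integrable f2 => // x /set_mem Ax; rewrite fg.
Qed.

Lemma L2_sum A (I : eqType) (s : seq I) (F : I -> pt R -> R) : measurable A ->
  (forall i, i \in s -> L2 A (F i)) -> L2 A (fun x => \sum_(i <- s) F i x).
Proof.
move=> mA; elim: s => [_|i s ih LF].
  apply: (@eq_L2 A (fun=> 0)) => // [x _|]; first by rewrite big_nil.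
  split=> //.
  by apply: (eq_integrable mA (cst 0%E)) => [x _|]; rewrite ?expr0n//; exact: integrable0.
apply: (@eq_L2 A (fun x => F i x + \sum_(j <- s) F j x)) => // [x _|].
  by rewrite big_cons.
apply: L2D => //; first exact/LF/mem_head.
by apply: ih => j js; apply: LF; rewrite in_cons js orbT.
Qed.

Lemma L2ipC A f g : L2ip A f g = L2ip A g f.
Proof. by apply: eq_Rintegral => x _; rewrite mulrC. Qed.

Lemma eq_L2ip A f g f' g' : (forall x, A x -> f x = f' x) ->
  (forall x, A x -> g x = g' x) -> L2ip A f g = L2ip A f' g'.
Proof.
move=> ff' gg'; apply: eq_Rintegral => x /set_mem Ax.
by rewrite ff'// gg'.
Qed.

Lemma L2ip_lin A (c : R) f g h : measurable A -> L2 A f -> L2 A g -> L2 A h ->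
  L2ip A (fun x => c * f x + g x) h = c * L2ip A f h + L2ip A g h.
Proof.
move=> mA Lf Lg Lh; rewrite /L2ip -RintegralZl//; last exact: L2_integrableM.
rewrite -RintegralD//; last exact: L2_integrableM.
- by apply: eq_Rintegral => x _; ring.
- have := L2_integrableM mA (L2Z c mA Lf) Lh.
  by apply: eq_integrable => // x _ /=; rewrite mulrA.
Qed.

Lemma L2ip_ge0 A f : 0 <= L2ip A f f.
Proof. by apply: Rintegral_ge0 => x _; rewrite -expr2 sqr_ge0. Qed.

Lemma L2norm_sq A f : L2norm A f ^+ 2 = L2ip A f f.
Proof.
rewrite /L2norm sqr_sqrtr; last by apply: Rintegral_ge0 => x _; rewrite sqr_ge0.
by apply: eq_Rintegral => x _; rewrite expr2.
Qed.

Lemma L2ip_setU A B f : measurable A -> measurable B -> A `&` B = set0 ->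
  L2 (A `|` B) f -> L2ip (A `|` B) f f = L2ip A f f + L2ip B f f.
Proof.
move=> mA mB AB Lf; apply: Rintegral_setU => //.
  by apply: L2_integrableM => //; exact: measurableU.
by apply/disj_setPS; rewrite AB.
Qed.

Lemma L2ip_subset A B f : measurable A -> measurable B -> A `<=` B ->
  L2 B f -> L2ip A f f <= L2ip B f f.
Proof.
move=> mA mB AB Lf; have mBA : measurable (B `\` A) by exact: measurableD.
have E : B = A `|` B `\` A by rewrite setDUK.
rewrite [in leRHS]E L2ip_setU -?E ?lerDl ?L2ip_ge0//.
by rewrite setIDA setIC -setIDA setDv setI0.
Qed.

(** Passing to A minus the first set keeps the remaining sets inside, which is
    why the ambient set A varies in the induction. *)
Lemma sum_L2ip_le A (I : eqType) (s : seq I) (F : I -> set (mpt R)) f :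
  measurable A -> L2 A f -> uniq s ->
  (forall i, i \in s -> measurable (F i)) ->
  (forall i, i \in s -> F i `<=` A) ->
  (forall i j, i \in s -> j \in s -> i != j -> F i `&` F j = set0) ->
  \sum_(i <- s) L2ip (F i) f f <= L2ip A f f.
Proof.
elim: s A => [|i s ih] A mA Lf /=; first by rewrite big_nil L2ip_ge0.
move=> /andP[is_ us] mF FA FI; rewrite big_cons.
have hi : i \in i :: s by exact: mem_head.
have hj j : j \in s -> j \in i :: s by rewrite in_cons => ->; rewrite orbT.
have mAi : measurable (A `\` F i) by apply: measurableD => //; exact: mF.
have E : A = F i `|` A `\` F i by rewrite setDUK//; exact: FA.
rewrite [in leRHS]E L2ip_setU -?E//; first 1 last.
- exact: mF.
- by rewrite setIDA setIC -setIDA setDv setI0.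
rewrite lerD2l; apply: ih => //.
- by apply: L2S Lf => //; exact: subDsetl.
- by move=> j /hj; exact: mF.
- move=> j js x Fjx; split; first exact: (FA j (hj _ js)).
  move=> Fix; have ij : i != j by apply/eqP => ij; move: is_; rewrite ij js.
  have : (F i `&` F j) x by [].
  by rewrite FI// hj.
- by move=> j k /hj js /hj ks; exact: FI.
Qed.

(** Linear spans are built one generator at a time, so that orthogonal
    projections can be constructed by the Gram-Schmidt recursion. *)
Fixpoint lspan (gs : seq (pt R -> R)) : set (pt R -> R) :=
  if gs is g :: gs' then
    [set p | exists c : R, exists2 q, lspan gs' q & p = (fun x => c * g x + q x)]
  else [set (fun=> 0)].

Lemma lspan_lin gs (a : R) p q : lspan gs p -> lspan gs q ->
  lspan gs (fun x => a * p x + q x).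
Proof.
elim: gs p q => [|g gs ih] p q /=.
  by move=> -> ->; apply: funext => x; rewrite mulr0 addr0.
move=> [c [p' sp ->]] [d [q' sq ->]]; exists (a * c + d).
exists (fun x => a * p' x + q' x); first exact: ih.
by apply: funext => x; ring.
Qed.

Lemma lspan_L2 A gs p : measurable A -> (forall i, (i < size gs)%N ->
  L2 A (nth (fun=> 0) gs i)) -> lspan gs p -> L2 A p.
Proof.
move=> mA; elim: gs p => [|g gs ih] p Lg /=.
  by move=> ->; have := @L2_sum A nat [::] (fun _ _ => 0) mA ltac:(by []);
    congr L2; apply: funext => x; rewrite big_nil.
move=> [c [q sq ->]]; apply: L2D => //; first by apply: L2Z => //; exact: (Lg 0%N).
by apply: ih => // i; exact: (Lg i.+1).
Qed.

(** The degenerate case of the Cauchy-Schwarz inequality: otherwise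
    the squared norm of t r + f, affine in t, would become negative. *)
Lemma L2ip_null A f r : measurable A -> L2 A f -> L2 A r ->
  L2ip A r r = 0 -> L2ip A f r = 0.
Proof.
move=> mA Lf Lr r0; apply: contrapT => /eqP fr.
(* makes the squared norm of t r + f equal to -1 *)
pose t := - (L2ip A f f + 1) / (2 * L2ip A f r).
have := L2ip_ge0 A (fun x => t * r x + f x).
have Ltr : L2 A (fun x => t * r x + f x) by apply: L2D => //; exact: L2Z.
rewrite L2ip_lin// [L2ip A r _]L2ipC [L2ip A f (fun _ => _)]L2ipC.
rewrite !L2ip_lin// r0 [L2ip A r f]L2ipC.
have -> : t * (t * 0 + L2ip A f r) + (t * L2ip A f r + L2ip A f f) = -1.
  by rewrite /t; field.
lra.
Qed.

(** Gram-Schmidt: if r is the part of g orthogonal to the earlier generators,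
    the projection gains the component of f along r. When r has norm zero this
    component is 0 by the convention for division by zero, and it is indeed
    orthogonality to r that [L2ip_null] provides. *)
Lemma lspan_proj A gs f : measurable A -> (forall i, (i < size gs)%N ->
  L2 A (nth (fun=> 0) gs i)) -> L2 A f ->
  exists2 p, lspan gs p & forall q, lspan gs q -> L2ip A (fun x => f x - p x) q = 0.
Proof.
move=> mA; elim: gs f => [|g gs ih] f Lgs Lf.
  exists (fun=> 0) => // q ->.
  rewrite /L2ip (@eq_Rintegral _ _ _ mu A (fun=> 0)); last by move=> x _; rewrite mulr0.
  by rewrite Rintegral_cst// mul0r.
have Lgs' i : (i < size gs)%N -> L2 A (nth (fun=> 0) gs i) by exact: (Lgs i.+1).
have Lg : L2 A g by exact: (Lgs 0%N).
have [p sp fp] := ih f Lgs' Lf; have [g' sg gg'] := ih g Lgs' Lg.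
have Lp : L2 A p by exact: lspan_L2 sp.
have Lg' : L2 A g' by exact: lspan_L2 sg.
pose r x := g x - g' x; pose h x := f x - p x.
have Lr : L2 A r by exact: L2B.
have Lh : L2 A h by exact: L2B.
(* equal to 0 when r has norm zero *)
pose b := L2ip A h r / L2ip A r r.
have hr : L2ip A h r = b * L2ip A r r.
  rewrite /b; have [r0|r0] := eqVneq (L2ip A r r) 0; last by rewrite divfK.
  by rewrite r0 mulr0 L2ip_null.
exists (fun x => b * g x + (- b * g' x + p x)).
  by exists b, (fun x => - b * g' x + p x); first exact: lspan_lin.
have -> : (fun x => f x - (b * g x + (- b * g' x + p x))) = (fun x => - b * r x + h x).
  by apply: funext => x; rewrite /r /h; ring.
move=> _ [c [q sq ->]].
have Lq : L2 A q by exact: lspan_L2 sq.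
rewrite L2ip_lin//; last by apply: L2D => //; exact: L2Z.
have gE k : L2 A k -> L2ip A g k = L2ip A r k + L2ip A k g'.
  move=> Lk; rewrite (L2ipC A k) -[L2ip A r k]mul1r -L2ip_lin//; congr L2ip.
  by apply: funext => x; rewrite /r; ring.
have ghq k : L2 A k -> L2ip A k (fun x => c * g x + q x)
    = c * (L2ip A r k + L2ip A k g') + L2ip A k q.
  by move=> Lk; rewrite L2ipC L2ip_lin// gE// (L2ipC A q).
rewrite !ghq// [L2ip A r g']gg'// [L2ip A r q]gg'// [L2ip A h g']fp// [L2ip A h q]fp//.
by rewrite (L2ipC A r h) hr; ring.
Qed.

End L2_theory.

(** * Borel sets of the plane and quadratic polynomials *)

Section plane_measure.
Variable R : realType.
Implicit Types (A : set (pt R)) (p q : pt R -> R).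

Lemma open_pt A : open A ->
  forall x, A x -> exists2 e : R, 0 < e & forall y,
    `|x.1 - y.1| < e -> `|x.2 - y.2| < e -> A y.
Proof.
move=> oA x Ax; have /nbhs_ballP[e /= e0 xe] : nbhs x A by exact: open_nbhs_nbhs.
by exists e => // y y1 y2; apply: xe; split.
Qed.

(** An open set is the union of the squares with rational centre and radius
    that it contains, and squares belong to the product sigma-algebra. *)
Lemma open_measurable_pt A : open A -> measurable (A : set (mpt R)).
Proof.
move=> oA.
pose box (a b r : rat) : set (mpt R) :=
  `]ratr a - ratr r, ratr a + ratr r[ `*` `]ratr b - ratr r, ratr b + ratr r[.
have -> : A = \bigcup_a \bigcup_b \bigcup_r
    (if `[< box a b r `<=` A >] then box a b r else set0).
  apply/seteqP; split=> [x Ax|x [a _ [b _ [r _]]]]; last first.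
    by case: asboolP => // + ?; apply.
  have [e e0 xe] := open_pt oA Ax.
  have near (y : R) (t : R) : 0 < t -> exists a : rat, `|y - ratr a| < t.
    move=> t0; have yt : y - t < y + t by lra.
    have [a] := rat_in_itvoo yt; rewrite in_itv/= => /andP[a1 a2].
    by exists a; rewrite ltr_norml; apply/andP; split; lra.
  have [r] : exists r : rat, ratr r \in `]e / 4, e / 2[ by apply: rat_in_itvoo; lra.
  rewrite in_itv/= => /andP[r1 r2].
  have [a xa] := near x.1 (e / 4) ltac:(lra).
  have [b xb] := near x.2 (e / 4) ltac:(lra).
  move: xa xb; rewrite !ltr_norml => /andP[xa1 xa2] /andP[xb1 xb2].
  exists a => //; exists b => //; exists r => //; case: asboolP => [_|]; last first.
    case=> -[y1 y2] [] /=; rewrite !in_itv/= => /andP[y11 y12] /andP[y21 y22].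
    by apply: xe; rewrite ltr_norml/=; apply/andP; split; lra.
  by split; rewrite /= in_itv/=; apply/andP; split; lra.
apply: bigcupT_measurable_rat => a; apply: bigcupT_measurable_rat => b.
apply: bigcupT_measurable_rat => r; case: ifP => // _.
by apply: measurableX; exact: measurable_itv.
Qed.

(** Boundedness by coordinates; in contrast to the filter-based notion this
    hands out one explicit bound. *)
Definition boxed A := exists M : R, forall x, A x -> `|x.1| <= M /\ `|x.2| <= M.

Lemma bounded_boxed A : bounded_set A -> boxed A.
Proof.
move=> /pinfty_ex_gt0[M _ hM]; exists M => x /hM /=.
by rewrite prod_normE ge_max => /andP[].
Qed.

Lemma boxed_finite A : measurable (A : set (mpt R)) -> boxed A ->
  (lebesgue2 R A < +oo)%E.
Proof.
move=> mA [M hM].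
have mB : measurable (`[- M, M] `*` `[- M, M] : set (mpt R)).
  by apply: measurableX; exact: measurable_itv.
apply: (@le_lt_trans _ _ (lebesgue2 R (`[- M, M] `*` `[- M, M]))).
  apply: le_measure; rewrite ?inE// => x /hM[x1 x2].
  by split; rewrite /= in_itv/= -ler_norml.
have -> : lebesgue2 R (`[- M, M] `*` `[- M, M])
    = (@lebesgue_measure R `[(- M)%R, M] * @lebesgue_measure R `[(- M)%R, M])%E.
  by apply: product_measure1E; exact: measurable_itv.
by rewrite lte_mul_pinfty// ?lebesgue_measure_itv/=; case: ifP => //; rewrite ?ltry.
Qed.

Lemma measurable_quadratic A p : quadratic p ->
  measurable_fun (A : set (mpt R)) (p : mpt R -> R).
Proof.
move=> [c0 [c1 [c2 [c3 [c4 [c5 hp]]]]]].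
have m1 : measurable_fun A (fst : mpt R -> R) by apply: measurable_funTS; exact: measurable_fst.
have m2 : measurable_fun A (snd : mpt R -> R) by apply: measurable_funTS; exact: measurable_snd.
rewrite (_ : p = fun x : mpt R => c0 + c1 * x.1 + c2 * x.2
          + c3 * x.1 ^+ 2 + c4 * (x.1 * x.2) + c5 * x.2 ^+ 2); last exact/funext.
by repeat first [exact: m1|exact: m2|exact: measurable_cst|
  apply: measurable_funD|apply: measurable_funX|apply: measurable_funM].
Qed.

Lemma L2_bounded A p : measurable (A : set (mpt R)) -> boxed A ->
  measurable_fun (A : set (mpt R)) (p : mpt R -> R) ->
  (exists M, forall x, A x -> `|p x| <= M) -> L2 A p.
Proof.
move=> mA bA mp [M hM]; split=> //.
apply: measurable_bounded_integrable => //; first exact: boxed_finite.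
  exact: measurable_funX.
exists (M ^+ 2); split=> [|r /ltW Mr x Ax /=]; first exact: num_real.
by rewrite (le_trans _ Mr)// normrX lerXn2r ?nnegrE// ?hM// (le_trans _ (hM _ Ax)).
Qed.

Lemma quadratic_bounded A p : boxed A -> quadratic p ->
  exists M, forall x, A x -> `|p x| <= M.
Proof.
move=> [M hM] [c0 [c1 [c2 [c3 [c4 [c5 hp]]]]]].
exists (`|c0| + `|c1| * M + `|c2| * M + `|c3| * M ^+ 2 + `|c4| * (M * M)
  + `|c5| * M ^+ 2) => x /hM[x1 x2]; rewrite hp.
have M0 : 0 <= M by rewrite (le_trans _ x1).
have m c y N : `|y| <= N -> `|c * y| <= `|c| * N.
  by move=> yN; rewrite normrM ler_wpM2l.
by do 5 (apply: (le_trans (ler_normD _ _)); apply: lerD; last by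
  apply: m; rewrite ?normrX ?normrM ?ler_pM// lerXn2r ?nnegrE).
Qed.

Lemma quadratic_L2 A p : measurable (A : set (mpt R)) -> boxed A ->
  quadratic p -> L2 A p.
Proof.
move=> mA bA qp; apply: L2_bounded => //; first exact: measurable_quadratic.
exact: quadratic_bounded.
Qed.

Lemma quadratic_lin (a : R) p q : quadratic p -> quadratic q ->
  quadratic (fun x => a * p x + q x).
Proof.
move=> [c0 [c1 [c2 [c3 [c4 [c5 hp]]]]]] [d0 [d1 [d2 [d3 [d4 [d5 hq]]]]]].
exists (a * c0 + d0), (a * c1 + d1), (a * c2 + d2), (a * c3 + d3),
  (a * c4 + d4), (a * c5 + d5) => x.
by rewrite hp hq; ring.
Qed.

Lemma quadratic_cst (c : R) : quadratic (fun=> c).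
Proof. by exists c, 0, 0, 0, 0, 0 => x; ring. Qed.

Lemma quadraticN p : quadratic p -> quadratic (- p).
Proof.
move=> /(quadratic_lin (-1)) /(_ (quadratic_cst 0)).
by congr quadratic; apply: funext => x; rewrite addr0 mulN1r.
Qed.

(** The difference quotient of a quadratic polynomial is affine in the
    increment h, so its limit is read off. *)
Lemma quadratic_derive (v : pt R) p : quadratic p ->
  exists2 q, quadratic q & forall x, is_derive x v p (q x).
Proof.
move=> [c0 [c1 [c2 [c3 [c4 [c5 hp]]]]]].
pose q (x : pt R) := c1 * v.1 + c2 * v.2 + c3 * (2 * x.1 * v.1)
  + c4 * (x.1 * v.2 + x.2 * v.1) + c5 * (2 * x.2 * v.2).
exists q.
  exists (c1 * v.1 + c2 * v.2), (2 * c3 * v.1 + c4 * v.2),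
    (c4 * v.1 + 2 * c5 * v.2), 0, 0, 0 => x; rewrite /q; ring.
move=> x.
pose e := c3 * v.1 ^+ 2 + c4 * (v.1 * v.2) + c5 * v.2 ^+ 2.
have cq : (h^-1 *: ((p \o shift x) (h *: v) - p x)) @[h --> (0 : R)^'] --> q x.
  have : (q x + h * e) @[h --> (0 : R)^'] --> q x + 0 * e.
    apply: cvgD; first exact: cvg_cst.
    apply: cvgM; last exact: cvg_cst.
    exact: nbhs_dnbhs.
  rewrite mul0r addr0; apply: cvg_trans; apply: near_eq_cvg.
  near=> h; rewrite /= !hp /= /q /e.
  have h0 : h != 0 by near: h; exact: nbhs_dnbhs_neq.
  rewrite /GRing.scale/=; field.
  exact: h0.
by split; [apply/cvg_ex; exists (q x)|exact: cvg_lim].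
Unshelve. all: by end_near. Qed.

Lemma quadratic_iterD p s : quadratic p -> quadratic (Defs.iterD p s).
Proof.
move=> qp; elim: s => //= i s ih; have [q qq hq] := quadratic_derive (dir R i) ih.
suff -> : (fun x => 'D_(dir R i) (Defs.iterD p s) x) = q by [].
by apply: funext => x; rewrite (@derive_val _ _ _ _ _ _ _ (hq x)).
Qed.

Lemma quadratic_deriveN (v x : pt R) p : quadratic p ->
  'D_v (- p) x = - 'D_v p x.
Proof.
move=> qp; have [q _ hq] := quadratic_derive v qp.
by rewrite derive.deriveN//; exact: (@ex_derive _ _ _ _ _ _ _ (hq x)).
Qed.

Lemma quadratic_iterDN p s : quadratic p -> Defs.iterD (- p) s = - Defs.iterD p s.
Proof.
move=> qp; elim: s => //= i s ih; apply: funext => x /=.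
rewrite -[LHS]/('D_(dir R i) (Defs.iterD (- p) s) x) ih quadratic_deriveN//.
exact: quadratic_iterD.
Qed.

End plane_measure.

(** * Triangles and triangulations *)

Section triangles.
Variable R : realType.
Implicit Types (a b c x : pt R) (K : tri R) (Om : set (pt R)) (T : seq (tri R)).

Lemma pt_eq (x y : pt R) : x.1 = y.1 -> x.2 = y.2 -> x = y.
Proof. by case: x y => [x1 x2] [y1 y2] /= -> ->. Qed.

(** The point of the plane with barycentric coordinates w. *)
Definition comb K (w : R * R * R) : pt R :=
  w.1.1 *: K.1.1 + w.1.2 *: K.1.2 + w.2 *: K.2.

(** Twice the area, up to a sign that encodes the orientation. *)
Definition det K : R := dot (K.1.2 - K.1.1) (Defs.rot (K.2 - K.1.1)).

Lemma sum3_tri a b c (w : 'I_3 -> R) :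
  \sum_i w i *: (verts (a, b, c))`_i
  = comb (a, b, c) (w ord0, w (lift ord0 ord0), w (lift ord0 (lift ord0 ord0))).
Proof. by rewrite !big_ord_recl big_ord0 addr0 /= addrA. Qed.

Lemma otriP K x : otri K x <-> exists w0 w1 w2 : R,
  [/\ [/\ 0 < w0, 0 < w1 & 0 < w2], w0 + w1 + w2 = 1 & x = comb K (w0, w1, w2)].
Proof.
case: K => [[a b] c]; split=> [[w [w0 w1 ->]]|[w0 [w1 [w2 [[p0 p1 p2] s ->]]]]].
  rewrite sum3_tri; do 3 eexists; split; [split| |reflexivity] => //.
  by rewrite -w1 !big_ord_recl big_ord0 addr0 addrA.
exists (fun i => [:: w0; w1; w2]`_i); split.
- by case=> [[|[|[|]]]].
- by rewrite !big_ord_recl big_ord0 /= addr0 addrA.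
- by rewrite sum3_tri.
Qed.

Lemma otri_hull K : otri K `<=` hull (verts K).
Proof.
case: K => [[a b] c] x [w [w0 w1 xE]].
by exists w; split=> // i; exact: ltW.
Qed.

(** Barycentric coordinates are unique in a nondegenerate triangle: the two
    differences of coordinates solve a homogeneous linear system whose
    determinant is [det K]. *)
Lemma comb_inj K w0 w1 w2 u0 u1 u2 : det K != 0 ->
  w0 + w1 + w2 = 1 -> u0 + u1 + u2 = 1 ->
  comb K (w0, w1, w2) = comb K (u0, u1, u2) -> [/\ w0 = u0, w1 = u1 & w2 = u2].
Proof.
case: K => [[[a1 a2] [b1 b2]] [c1 c2]]; rewrite /det/dot/comb/Defs.rot/= => d0 ws us.
move=> /(congr1 (fun z : pt R => (z.1, z.2))) [].
rewrite /GRing.scale/= => e1 e2.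
have W0 : w0 = 1 - w1 - w2 by lra.
have U0 : u0 = 1 - u1 - u2 by lra.
rewrite W0 U0 in e1 e2.
have F1 : (w1 - u1) * (b1 - a1) = (u2 - w2) * (c1 - a1) by lra.
have F2 : (w1 - u1) * (b2 - a2) = (u2 - w2) * (c2 - a2) by lra.
have w1E : w1 - u1 = 0.
  apply: (mulIf d0); rewrite mul0r mulrDr !mulrA F2.
  have -> : (w1 - u1) * (b1 - a1) * - (c2 - a2) = (u2 - w2) * (c1 - a1) * - (c2 - a2).
    by rewrite F1.
  ring.
have w2E : u2 - w2 = 0.
  apply: (mulIf d0); rewrite mul0r.
  have -> : (u2 - w2) * ((b1 - a1) * - (c2 - a2) + (b2 - a2) * (c1 - a1)) =
    (b2 - a2) * ((u2 - w2) * (c1 - a1)) - (b1 - a1) * ((u2 - w2) * (c2 - a2)) by ring.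
  by rewrite -F1 -F2; ring.
by split=> //; lra.
Qed.

Lemma det_area K : area K = `|det K| / 2.
Proof. by []. Qed.

Lemma det_neq0 K : 0 < area K -> det K != 0.
Proof. by rewrite det_area; apply: contraTneq => ->; rewrite normr0 mul0r ltxx. Qed.

Lemma open_halfplane (k0 k1 k2 : R) : open [set x : pt R | 0 < k0 + k1 * x.1 + k2 * x.2].
Proof.
have cf : continuous (fun x : pt R => k0 + k1 * x.1 + k2 * x.2).
  move=> x; apply: cvgD; last by apply: cvgM; [exact: cvg_cst|exact: cvg_snd].
  by apply: cvgD; [exact: cvg_cst|apply: cvgM; [exact: cvg_cst|exact: cvg_fst]].
by apply: (@open_comp _ _ _ [set y : R | 0 < y]) => [x _|]; [exact: cf|exact: open_gt].
Qed.

(** By Cramer's rule the barycentric coordinates are affine functions of the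
    point, so that the open triangle is an intersection of three open
    half-planes. *)
Lemma open_otri K : 0 < area K -> open (otri K).
Proof.
move=> /det_neq0; case: K => [[a b] c] d0.
pose D := det (a, b, c).
pose k1 (x : pt R) := dot (x - a) (Defs.rot (c - a)) / D.
pose k2 (x : pt R) := - dot (x - a) (Defs.rot (b - a)) / D.
have aff k : (exists u v : pt R, forall x, k x = dot (x - u) v / D) ->
  forall s : R, exists k0 k1' k2' : R, forall x, s * k x = k0 + k1' * x.1 + k2' * x.2.
  move=> [u [v kE]] s; exists (- s * (u.1 * v.1 + u.2 * v.2) / D), (s * v.1 / D), (s * v.2 / D) => x.
  by rewrite kE /dot/=; ring.
have open3 k (s t : R) : (exists u v : pt R, forall x, k x = dot (x - u) v / D) ->
  open [set x : pt R | 0 < t + s * k x].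
  move=> /aff /(_ s)[k0 [k1' [k2' kE]]].
  rewrite (_ : [set x | _] = [set x : pt R | 0 < t + k0 + k1' * x.1 + k2' * x.2]).
    exact: open_halfplane.
  by apply/seteqP; split=> x /=; rewrite kE !addrA.
have -> : otri (a, b, c) = [set x | 0 < 0 + 1 * k1 x] `&` [set x | 0 < 0 + 1 * k2 x]
    `&` [set x | 0 < 1 + (-1) * (k1 x + k2 x)].
  have kE w0 w1 w2 : w0 + w1 + w2 = 1 ->
      k1 (comb (a, b, c) (w0, w1, w2)) = w1 /\ k2 (comb (a, b, c) (w0, w1, w2)) = w2.
    move=> ws; have -> : w0 = 1 - w1 - w2 by lra.
    move: d0; rewrite /k1/k2/D/det/dot/comb/Defs.rot/= /GRing.scale/= => d0.
    by split; field; exact: d0.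
  apply/seteqP; split=> x.
    move=> /otriP[w0 [w1 [w2 [[p0 p1 p2] ws ->]]]].
    by have [/= -> ->] := kE _ _ _ ws; split; [split|]; lra.
  move=> [[/= p1 p2] p0]; apply/otriP; exists (1 - k1 x - k2 x), (k1 x), (k2 x).
  split; [split; lra|lra|].
  move: d0 {aff open3 kE p0 p1 p2}; case: x => x1 x2.
  rewrite /k1/k2/D/det/comb/dot/Defs.rot/= /GRing.scale/= => d0.
  by apply: pt_eq => /=; rewrite /GRing.scale/=; field; exact: d0.
apply: openI; [apply: openI|]; apply: open3.
- by exists a, (Defs.rot (c - a)).
- by exists a, (- Defs.rot (b - a)) => x; rewrite /k2 /dot/=; ring.
- exists a, (Defs.rot (c - a) - Defs.rot (b - a)) => x; rewrite /k1 /k2 /dot/=; ring.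
Qed.

Lemma measurable_otri K : 0 < area K -> measurable (otri K : set (mpt R)).
Proof. by move=> /open_otri /open_measurable_pt. Qed.

Lemma boxed_otri K : boxed (otri K).
Proof.
exists (`|K.1.1| + `|K.1.2| + `|K.2|) => x /otriP[w0 [w1 [w2 [[p0 p1 p2] ws ->]]]].
have h (i : pt R -> R) : (forall y, `|i y| <= `|y|) ->
   `|w0 * i K.1.1 + w1 * i K.1.2 + w2 * i K.2| <= `|K.1.1| + `|K.1.2| + `|K.2|.
  move=> iy; have hw w y : 0 < w -> w <= 1 -> `|w * i y| <= `|y|.
    move=> w0' w1'; rewrite normrM gtr0_norm//.
    by rewrite (le_trans _ (iy y))// ler_piMl.
  apply: (le_trans (ler_normD _ _)); apply: lerD; last by apply: hw => //; lra.
  by apply: (le_trans (ler_normD _ _)); apply: lerD; apply: hw => //; lra.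
by split; apply: h => y; rewrite prod_normE le_max lexx ?orbT.
Qed.

Lemma quadratic_L2_otri K p : 0 < area K -> quadratic p -> L2 (otri K) p.
Proof. by move=> a0; apply: quadratic_L2; [exact: measurable_otri|exact: boxed_otri]. Qed.

Section bisection.
Variables a b c : pt R.

(** The two children of a bisection have half the area each and lie disjointly
    in their parent; everything follows from their barycentric coordinates
    with respect to the parent. *)
Lemma area_bisectl : area (c, a, mid (a, b)) = area (a, b, c) / 2.
Proof.
rewrite !det_area; congr (_ / 2).
have -> : det (c, a, mid (a, b)) = det (a, b, c) / 2.
  by rewrite /det/dot/Defs.rot/mid/= /GRing.scale/=; field.
by rewrite normrM [X in _ * X]gtr0_norm// invr_gt0.
Qed.

Lemma area_bisectr : area (b, c, mid (a, b)) = area (a, b, c) / 2.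
Proof.
rewrite !det_area; congr (_ / 2).
have -> : det (b, c, mid (a, b)) = det (a, b, c) / 2.
  by rewrite /det/dot/Defs.rot/mid/= /GRing.scale/=; field.
by rewrite normrM [X in _ * X]gtr0_norm// invr_gt0.
Qed.

Lemma comb_bisectl w0 w1 w2 : comb (c, a, mid (a, b)) (w0, w1, w2) =
  comb (a, b, c) (w1 + w2 / 2, w2 / 2, w0).
Proof.
by rewrite /comb/mid/=; apply: pt_eq; rewrite /= /GRing.scale/=; field.
Qed.

Lemma comb_bisectr w0 w1 w2 : comb (b, c, mid (a, b)) (w0, w1, w2) =
  comb (a, b, c) (w2 / 2, w0 + w2 / 2, w1).
Proof.
by rewrite /comb/mid/=; apply: pt_eq; rewrite /= /GRing.scale/=; field.
Qed.

Lemma otri_bisectl : otri (c, a, mid (a, b)) `<=` otri (a, b, c).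
Proof.
move=> x /otriP[w0 [w1 [w2 [[p0 p1 p2] ws ->]]]]; apply/otriP.
by rewrite comb_bisectl; do 3 eexists; split; [split| |reflexivity]; lra.
Qed.

Lemma otri_bisectr : otri (b, c, mid (a, b)) `<=` otri (a, b, c).
Proof.
move=> x /otriP[w0 [w1 [w2 [[p0 p1 p2] ws ->]]]]; apply/otriP.
by rewrite comb_bisectr; do 3 eexists; split; [split| |reflexivity]; lra.
Qed.

(** On the left child the coordinate of a exceeds that of b, on the right
    child it is the other way round. *)
Lemma otri_bisectI : det (a, b, c) != 0 ->
  otri (c, a, mid (a, b)) `&` otri (b, c, mid (a, b)) = set0.
Proof.
move=> d0; rewrite -subset0 => x [].
move=> /otriP[w0 [w1 [w2 [[p0 p1 p2] ws ->]]]].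
move=> /otriP[u0 [u1 [u2 [[q0 q1 q2] us]]]].
rewrite comb_bisectl comb_bisectr => /(comb_inj d0)[]; lra.
Qed.

End bisection.

(** A point of a proper face has a vanishing barycentric coordinate. *)
Lemma hull_common K (p : pred (pt R)) x : (size [seq z <- verts K | p z] < 3)%N ->
  hull [seq z <- verts K | p z] x -> exists w0 w1 w2 : R,
  [/\ w0 * w1 * w2 = 0, w0 + w1 + w2 = 1 & x = comb K (w0, w1, w2)].
Proof.
case: K => [[a b] c] /=; rewrite /comb/=.
case: (p a); case: (p b); case: (p c) => //= _ [w [_ ws ->]];
  move: ws; rewrite ?big_ord_recl ?big_ord0/= ?addr0 => ws.
- exists (w ord0), (w (lift ord0 ord0)), 0; split; rewrite ?mulr0 ?addr0//.
  by rewrite scale0r addr0.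
- exists (w ord0), 0, (w (lift ord0 ord0)); split; rewrite ?mulr0 ?mul0r ?addr0//.
  by rewrite scale0r addr0.
- exists (w ord0), 0, 0; split; rewrite ?mulr0 ?mul0r ?addr0//.
  by rewrite !scale0r !addr0.
- exists 0, (w ord0), (w (lift ord0 ord0)); split; rewrite ?mulr0 ?mul0r ?add0r//.
  by rewrite scale0r add0r.
- exists 0, (w ord0), 0; split; rewrite ?mulr0 ?mul0r ?add0r ?addr0//.
  by rewrite !scale0r addr0 add0r.
- exists 0, 0, (w ord0); split; rewrite ?mulr0 ?mul0r ?add0r ?addr0//.
  by rewrite !scale0r !add0r.
- by exfalso; lra.
Qed.

(** Two distinct triangles meet in a proper face, which contains no point of
    the open triangle. *)
Lemma triangulation_disjoint Om T K K' : triangulation Om T ->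
  K \in T -> K' \in T -> K != K' -> otri K `&` otri K' = set0.
Proof.
move=> [_ ar _ hT] KT KT' KK'; have [s3 hI] := hT _ _ KT KT' KK'.
rewrite -subset0 => x [xK xK'].
have : hull [seq z <- verts K | z \in verts K'] x by rewrite -hI; split; exact: otri_hull.
move=> /(hull_common s3)[w0 [w1 [w2 [w012 ws xE]]]].
have /otriP[u0 [u1 [u2 [[p0 p1 p2] us xE']]]] := xK.
rewrite xE in xE'.
have [e0 e1 e2] := comb_inj (det_neq0 (ar _ KT)) ws us xE'.
have := mulr_gt0 (mulr_gt0 p0 p1) p2.
by rewrite -e0 -e1 -e2 w012 ltxx.
Qed.

(** A Lipschitz domain has no slits: it is the interior of its closure. Below
    a boundary point p, in the frame where the domain is an epigraph, there is
    a whole cone outside the closure; if p were interior to the closure, the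
    point y at distance s below p would be a limit of points of the domain, all of which lie above the graph. *)
Lemma lipschitz_interior_closure Om (U : set (pt R)) : open Om ->
  lipschitz_boundary Om -> open U -> U `<=` closure Om -> U `<=` Om.
Proof.
move=> oOm lip oU UOm p Up; apply: contrapT => nOm.
have bp : boundary Om p.
  by split; [exact: UOm|rewrite (interior_id _).1].
have [t [g [L [tt gL /nbhs_ballP[e /= e0 he]]]]] := lip p bp.
have [r r0 hr] := open_pt oU Up.
case: t tt he => t1 t2; rewrite /dot/Defs.rot/= => tt he.
have gp : p.1 * - t2 + p.2 * t1 <= g (p.1 * t1 + p.2 * t2).
  rewrite leNgt; apply/negP => gp; apply: nOm.
  exact: (he p (ballxx _ e0)).2.
have [a1 a2] : `|t1| <= 1 /\ `|t2| <= 1.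
  by split; rewrite -(@ler_sqr _ `|_|) ?nnegrE// real_normK ?num_real//; nra.
pose s := Num.min r e / 4.
have [s0 sr se] : [/\ 0 < s, 4 * s <= r & 4 * s <= e].
  have -> : 4 * s = Num.min r e by rewrite /s; field.
  by rewrite !ge_min !lexx orbT divr_gt0// lt_min r0.
pose D := 1 + `|L|; have D0 : 1 <= D by rewrite lerDl.
(* small against s, even after multiplication by the Lipschitz constant *)
pose rho := s / (4 * D).
have rho0 : 0 < rho by rewrite divr_gt0// mulr_gt0//; lra.
have rhoD : 4 * (D * rho) = s by rewrite /rho; field; rewrite gt_eqF//; lra.
have Dr : rho <= D * rho by rewrite ler_peMl// ltW.
pose y : pt R := (p.1 + s * t2, p.2 - s * t1).
move: a1 a2; rewrite !ler_norml => /andP[t1l t1u] /andP[t2l t2u].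
have Uy : U y.
  by apply: hr; rewrite /= ltr_norml; apply/andP; split; nra.
have [z [Oz [zy1 zy2]]] := UOm y Uy (ball y rho) (nbhsx_ballx y rho rho0).
move: zy1 zy2; rewrite /ball/= !ltr_norml => /andP[z1l z1u] /andP[z2l z2u].
have /he : ball p e z.
  by split; rewrite /ball/= ltr_norml; apply/andP; split; nra.
move=> [/(_ Oz) + _]; apply/negP; rewrite -leNgt.
have := gL (p.1 * t1 + p.2 * t2) (z.1 * t1 + z.2 * t2).
have zt : `|p.1 * t1 + p.2 * t2 - (z.1 * t1 + z.2 * t2)| <= 2 * rho.
  have -> : p.1 * t1 + p.2 * t2 - (z.1 * t1 + z.2 * t2)
    = (y.1 - z.1) * t1 + (y.2 - z.2) * t2 by rewrite /y/=; ring.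
  by rewrite /y/= ler_norml; apply/andP; split; nra.
have Lr : L * `|p.1 * t1 + p.2 * t2 - (z.1 * t1 + z.2 * t2)| <= 2 * (`|L| * rho).
  rewrite mulrCA; apply: (le_trans (ler_wpM2r _ (ler_norm L))) => //.
  exact: ler_wpM2l.
have DL : D * rho = rho + `|L| * rho by rewrite /D; ring.
move=> /(le_trans (ler_norm _)) gg.
have zr : z.1 * - t2 + z.2 * t1 <= p.1 * - t2 + p.2 * t1 - s + 2 * rho.
  have -> : z.1 * - t2 + z.2 * t1 = p.1 * - t2 + p.2 * t1 - s * (t1 * t1 + t2 * t2)
     + ((y.1 - z.1) * t2 - (y.2 - z.2) * t1) by rewrite /y/=; ring.
  by rewrite tt mulr1 lerD2l /y/=; nra.
lra.
Qed.

Lemma otri_subset Om T K : open Om -> lipschitz_boundary Om ->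
  triangulation Om T -> K \in T -> otri K `<=` Om.
Proof.
move=> oOm lip [_ ar cl _] KT; apply: lipschitz_interior_closure => //.
  exact/open_otri/ar.
by rewrite cl => x /otri_hull xK; exists K.
Qed.

End triangles.

(** * Residuals weighted by the mesh size *)

Section meshes.
Variable R : realType.
Implicit Types (K : tri R) (Om : set (pt R)) (T : seq (tri R)) (f g : pwfun R).

(** The common form of the volume and the oscillation terms. *)
Definition wsum T f : R := \sum_(K <- T) hT K ^+ 4 * L2ip (otri K) (f K) (f K).

Lemma hT4 K : hT K ^+ 4 = area K ^+ 2.
Proof.
by rewrite /hT -[4%N]/(2 * 2)%N exprM sqr_sqrtr// /area divr_ge0.
Qed.

Lemma hT4_ge0 K : 0 <= hT K ^+ 4.
Proof. by rewrite hT4 sqr_ge0. Qed.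

Lemma wsum_ge0 T f : 0 <= wsum T f.
Proof. by apply: sumr_ge0 => K _; rewrite mulr_ge0 ?hT4_ge0 ?L2ip_ge0. Qed.

Lemma nvb_sub K s : nvb K s -> 0 < area K ->
  forall K', K' \in s -> 0 < area K' /\ otri K' `<=` otri K.
Proof.
elim=> [K0 K00 K'|a b c s1 s2 _ ih1 _ ih2 abc0 K'].
  by rewrite inE => /eqP ->; split.
rewrite mem_cat => /orP[/ih1|/ih2]; rewrite ?area_bisectl ?area_bisectr.
  case; first by rewrite divr_gt0.
  by move=> ? h; split=> // x /h; exact: otri_bisectl.
case; first by rewrite divr_gt0.
by move=> ? h; split=> // x /h; exact: otri_bisectr.
Qed.

Lemma nvb_vertex K s : nvb K s ->
  forall z, z \in verts K -> exists2 K', K' \in s & z \in verts K'.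
Proof.
elim=> [K0 z zK|a b c s1 s2 _ ih1 _ ih2 z]; first by exists K0 => //; rewrite inE.
have l z' : z' \in verts (c, a, mid (a, b)) -> exists2 K', K' \in s1 ++ s2 & z' \in verts K'.
  by move=> /ih1[K' K's zK']; exists K' => //; rewrite mem_cat K's.
have r z' : z' \in verts (b, c, mid (a, b)) -> exists2 K', K' \in s1 ++ s2 & z' \in verts K'.
  by move=> /ih2[K' K's zK']; exists K' => //; rewrite mem_cat K's orbT.
rewrite !inE => /or3P[] /eqP ->.
- by apply: l; rewrite !inE eqxx orbT.
- by apply: r; rewrite !inE eqxx.
- by apply: l; rewrite !inE eqxx.
Qed.

Lemma wsum_cat T T' f : wsum (T ++ T') f = wsum T f + wsum T' f.
Proof. by rewrite /wsum big_cat. Qed.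

Lemma wsum1 K f : wsum [:: K] f = hT K ^+ 4 * L2ip (otri K) (f K) (f K).
Proof. by rewrite /wsum big_seq1. Qed.

(** Here h_T^4 is the square of the area, which a bisection divides by 4. *)
Lemma bisect_wsum a b c (h : pt R -> R) : 0 < area (a, b, c) -> L2 (otri (a, b, c)) h ->
  wsum [:: (c, a, mid (a, b)); (b, c, mid (a, b))] (fun=> h)
  <= 4^-1 * wsum [:: (a, b, c)] (fun=> h).
Proof.
move=> abc0 Lh; rewrite /wsum !big_cons !big_nil !addr0 !hT4.
rewrite area_bisectl area_bisectr -mulrDr.
rewrite [leRHS](_ : _ = (area (a, b, c) / 2) ^+ 2 * L2ip (otri (a, b, c)) h h);
  last by field.
rewrite ler_wpM2l ?sqr_ge0//.
have ml : measurable (otri (c, a, mid (a, b)) : set (mpt R)).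
  by apply: measurable_otri; rewrite area_bisectl divr_gt0.
have mr : measurable (otri (b, c, mid (a, b)) : set (mpt R)).
  by apply: measurable_otri; rewrite area_bisectr divr_gt0.
have sub : otri (c, a, mid (a, b)) `|` otri (b, c, mid (a, b)) `<=` otri (a, b, c).
  by move=> x [|]; [exact: otri_bisectl|exact: otri_bisectr].
have mabc := measurable_otri abc0.
rewrite -L2ip_setU//; [|exact/otri_bisectI/det_neq0|].
- by apply: L2ip_subset => //; exact: measurableU.
- by apply: L2S Lh => //; exact: measurableU.
Qed.

Lemma nvb_wsum K s (h : pt R -> R) : nvb K s -> 0 < area K -> L2 (otri K) h ->
  wsum s (fun=> h) <= wsum [:: K] (fun=> h).
Proof.
elim=> [//|a b c s1 s2 _ ih1 _ ih2 abc0 Lh].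
have l0 : 0 < area (c, a, mid (a, b)) by rewrite area_bisectl divr_gt0.
have r0 : 0 < area (b, c, mid (a, b)) by rewrite area_bisectr divr_gt0.
rewrite wsum_cat; apply: (le_trans (lerD (ih1 l0 _) (ih2 r0 _))).
- by apply: L2S Lh; [exact: measurable_otri..|exact: otri_bisectl].
- by apply: L2S Lh; [exact: measurable_otri..|exact: otri_bisectr].
rewrite -wsum_cat /=; apply: (le_trans (bisect_wsum abc0 Lh)).
by rewrite ler_piMl ?wsum_ge0//; lra.
Qed.

Lemma nvb_wsum_refined K s (h : pt R -> R) : nvb K s -> 0 < area K -> L2 (otri K) h ->
  K \notin s -> wsum s (fun=> h) <= 4^-1 * wsum [:: K] (fun=> h).
Proof.
case=> [K0|a b c s1 s2 n1 n2 abc0 Lh _]; first by rewrite inE eqxx.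
have l0 : 0 < area (c, a, mid (a, b)) by rewrite area_bisectl divr_gt0.
have r0 : 0 < area (b, c, mid (a, b)) by rewrite area_bisectr divr_gt0.
rewrite wsum_cat; apply: (le_trans (lerD (nvb_wsum n1 l0 _) (nvb_wsum n2 r0 _))).
- by apply: L2S Lh; [exact: measurable_otri..|exact: otri_bisectl].
- by apply: L2S Lh; [exact: measurable_otri..|exact: otri_bisectr].
by rewrite -wsum_cat /=; exact: bisect_wsum.
Qed.

Lemma refinement_vertex T T' : refinement T T' -> forall z K, K \in T ->
  z \in verts K -> exists2 K', K' \in T' & z \in verts K'.
Proof.
move=> [F nF pT'] z K KT /(nvb_vertex (nF K KT))[K' K'F zK'].
exists K' => //; rewrite (perm_mem pT'); apply/flattenP.
by exists (F K) => //; exact: map_f.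
Qed.

(** The elements that survive the refinement keep their contribution, whereas
    every bisected one loses at least the factor 4. The fine family f' may be
    replaced by anything smaller in norm than f on each fine triangle; this
    covers both the same function on two meshes and best approximations. *)
Lemma refinement_wsum T T' f f' : refinement T T' ->
  (forall K, K \in T -> 0 < area K) ->
  (forall K, K \in T -> L2 (otri K) (f K)) ->
  (forall K K', K \in T -> K' \in T' -> 0 < area K' -> otri K' `<=` otri K ->
    L2ip (otri K') (f' K') (f' K') <= L2ip (otri K') (f K) (f K)) ->
  wsum T' f' <= wsum T f - 3 / 4 * wsum [seq K <- T | K \notin T'] f.
Proof.
move=> [F nF pT'] aT LfT ff'.
have step K : K \in T -> wsum (F K) f'
    <= wsum [:: K] f - (if K \notin T' then 3 / 4 * wsum [:: K] f else 0).
  move=> KT; have aK := aT K KT; have sub := nvb_sub (nF K KT) aK.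
  have FT' K' : K' \in F K -> K' \in T'.
    move=> K'F; rewrite (perm_mem pT'); apply/flattenP.
    by exists (F K) => //; exact: map_f.
  have le1 : wsum (F K) f' <= wsum (F K) (fun=> f K).
    rewrite /wsum big_seq [leRHS]big_seq; apply: ler_sum => K' K'F.
    have [aK' sK'] := sub K' K'F.
    by rewrite ler_wpM2l ?hT4_ge0// ff'// FT'.
  apply: (le_trans le1); case: ifPn => KT'.
    have KF : K \notin F K by apply: contraNN KT'; exact: FT'.
    have := nvb_wsum_refined (nF K KT) aK (LfT K KT) KF.
    rewrite !wsum1; lra.
  by rewrite subr0; have := nvb_wsum (nF K KT) aK (LfT K KT); rewrite !wsum1.
have -> : wsum T' f' = \sum_(K <- T) wsum (F K) f'.
  by rewrite /wsum (perm_big _ pT')/= big_flatten big_map.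
have -> : wsum T f = \sum_(K <- T) wsum [:: K] f.
  by apply: eq_bigr => K _; rewrite wsum1.
have -> : wsum [seq K <- T | K \notin T'] f
    = \sum_(K <- T) (if K \notin T' then wsum [:: K] f else 0).
  by rewrite /wsum big_filter big_mkcond; apply: eq_bigr => K _; rewrite -/(wsum _ _) wsum1.
rewrite mulr_sumr -sumrB big_seq [leRHS]big_seq; apply: ler_sum => K KT.
by apply: (le_trans (step K KT)); case: ifP; rewrite ?mulr0.
Qed.

End meshes.

(** * Piecewise polynomials *)

Section piecewise.
Variable R : realType.
Implicit Types (K : tri R) (Om A : set (pt R)) (T : seq (tri R)) (v w : pwfun R).

Lemma pw_otri Om T v s K x : triangulation Om T -> K \in T -> otri K x ->
  pw T v s x = Defs.iterD (v K) s x.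
Proof.
move=> tT KT xK; have [uT _ _ _] := tT.
rewrite /pw (bigD1_seq K)//= indicE mem_set// mul1r big_seq_cond big1 ?addr0//.
move=> K' /andP[K'T K'K]; rewrite indicE memNset ?mul0r// => xK'.
have : (otri K' `&` otri K) x by [].
by rewrite (triangulation_disjoint tT).
Qed.

Lemma pw_L2 Om T v s A : triangulation Om T ->
  (forall K, K \in T -> quadratic (v K)) ->
  measurable (A : set (mpt R)) -> boxed A -> L2 A (pw T v s).
Proof.
move=> [_ aT _ _] qv mA bA; apply: L2_sum => // K KT.
have qi := quadratic_iterD s (qv K KT).
have mi : measurable_fun (A : set (mpt R)) (\1_(otri K : set (mpt R)) : mpt R -> R).
  by apply: measurable_indic; apply: measurable_otri; apply: aT.
apply: L2_bounded => //.
  exact: (measurable_funM mi (measurable_quadratic qi)).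
have [M hM] := quadratic_bounded bA qi.
exists M => x Ax; rewrite indicE; case: (_ \in _); rewrite ?mul1r ?hM//.
by rewrite mul0r normr0 (le_trans _ (hM _ Ax)).
Qed.

Lemma pwN T v s : (forall K, K \in T -> quadratic (v K)) ->
  pw T (fun K => - v K) s = - pw T v s.
Proof.
move=> qv; apply: funext => x; rewrite /pw -[RHS]sumrN big_seq [RHS]big_seq.
apply: eq_bigr => K KT; rewrite quadratic_iterDN; last exact: qv.
by rewrite -mulrN.
Qed.

Lemma morleyN Om T v : morley Om T v -> morley Om T (fun K => - v K).
Proof.
move=> [qv cv bv jv]; split.
- by move=> K KT; exact/quadraticN/qv.
- by move=> K K' z KT K'T zK zK' Oz; rewrite -[LHS]/(- v K z) (cv K K' z).
- by move=> K z KT zK Oz; rewrite -[LHS]/(- v K z) (bv K z)// oppr0.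
- move=> K E KT EK; have := jv K E KT EK; rewrite /jump => jKE.
  rewrite quadratic_deriveN; last exact: qv.
  rewrite big_seq_cond.
  rewrite (eq_bigr (fun K' => - 'D_(Defs.rot (tangent E)) (v K') (mid E))).
    by rewrite -big_seq_cond sumrN -opprD jKE oppr0.
  by move=> K' /andP[K'T _]; rewrite quadratic_deriveN//; exact: qv.
Qed.

Lemma Dip_ge0 m A (a : jet R) : 0 <= Dip m A a a.
Proof. by apply: sumr_ge0 => s _; exact: L2ip_ge0. Qed.

Lemma Dnorm_sq m A (a : jet R) : Dnorm m A a ^+ 2 = Dip m A a a.
Proof. by rewrite /Dnorm sqr_sqrtr// Dip_ge0. Qed.

(** The identity |p|^2 = |p - q|^2 - |q|^2 + 2 (p, q) with p = a - b and
    q = a - c. *)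
Lemma Dip_polar m A (a b c : jet R) : measurable (A : set (mpt R)) ->
  (forall s, size s = m -> L2 A (a s)) -> (forall s, size s = m -> L2 A (b s)) ->
  (forall s, size s = m -> L2 A (c s)) ->
  Dnorm m A (a - b) ^+ 2 =
  Dnorm m A (c - b) ^+ 2 - Dnorm m A (c - a) ^+ 2 + 2 * Dip m A (a - b) (a - c).
Proof.
move=> mA La Lb Lc; rewrite !Dnorm_sq /Dip mulr_sumr -sumrB -big_split/=.
apply: eq_bigr => s _; have ss := size_tuple s.
pose p x := a s x - b s x; pose q x := a s x - c s x.
have Lp : L2 A p by apply: L2B => //; [exact: La|exact: Lb].
have Lq : L2 A q by apply: L2B => //; [exact: La|exact: Lc].
have pq k : L2 A k -> L2ip A (fun x => -1 * q x + p x) k = - L2ip A q k + L2ip A p k.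
  by move=> Lk; rewrite L2ip_lin// mulN1r.
have Lpq : L2 A (fun x => -1 * q x + p x) by apply: L2D => //; exact: L2Z.
rewrite [L2ip A ((c - b) s) _](_ : _ = L2ip A (fun x => -1 * q x + p x) (fun x => -1 * q x + p x)); last first.
  by congr L2ip; apply: funext => x; rewrite /p/q !fctE; ring.
rewrite [L2ip A ((c - a) s) _](_ : _ = L2ip A q q); last first.
  by apply: eq_Rintegral => x _; rewrite /q !fctE; ring.
rewrite -[L2ip A ((a - b) s) ((a - b) s)]/(L2ip A p p) -[L2ip A ((a - b) s) _]/(L2ip A p q).
have kpq k : L2 A k -> L2ip A k (fun x => -1 * q x + p x) = - L2ip A q k + L2ip A p k.
  by move=> Lk; rewrite L2ipC pq.
by rewrite pq// !kpq// (L2ipC A q p); ring.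
Qed.

(** The embedding is given for sums; differences are covered because the
    Morley space is closed under negation. *)
Lemma discrete_embedding_L2 Om (kappa C delta : R) T T' v v' : 0 < C ->
  discrete_embedding Om kappa C -> TT Om kappa delta T -> TT Om kappa delta T' ->
  refinement T T' -> morley Om T v -> morley Om T' v' ->
  L2norm Om ((pw T' v' - pw T v) [::]) <= C * Dnorm 2 Om (pw T' v' - pw T v).
Proof.
move=> C0 emb tT tT' ref mv mv'.
have := emb delta T T' _ _ tT tT' ref (morleyN mv) mv'.
have -> : pw T (fun K => - v K) + pw T' v' = pw T' v' - pw T v.
  apply: funext => s; rewrite addrC [LHS]fctE [RHS]fctE pwN//.
  by case: mv.
move=> /= h; rewrite -lee_fin; apply: le_trans h.
by rewrite -addeA leeDl// adde_ge0 ?lee_fin ?sqrtr_ge0// Lnorm_ge0.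
Qed.

Section projection.
Variables (K : tri R) (f : pt R -> R).
Hypotheses (aK : 0 < area K) (Lf : L2 (otri K) f).

Definition monomials : seq (pt R -> R) :=
  [:: fun=> 1; fun x => x.1; fun x => x.2; fun x => x.1 ^+ 2;
      fun x => x.1 * x.2; fun x => x.2 ^+ 2].

Lemma monomials_quadratic i : quadratic (nth (fun=> 0) monomials i).
Proof.
case: i => [|[|[|[|[|[|i]]]]]] /=.
- by exists 1, 0, 0, 0, 0, 0 => x; ring.
- by exists 0, 1, 0, 0, 0, 0 => x; ring.
- by exists 0, 0, 1, 0, 0, 0 => x; ring.
- by exists 0, 0, 0, 1, 0, 0 => x; ring.
- by exists 0, 0, 0, 0, 1, 0 => x; ring.
- by exists 0, 0, 0, 0, 0, 1 => x; ring.
- by rewrite nth_nil; exact: quadratic_cst.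
Qed.

Lemma quadratic_lspan p : quadratic p <-> lspan monomials p.
Proof.
split=> [[c0 [c1 [c2 [c3 [c4 [c5 hp]]]]]]|].
  exists c0, (fun x => c1 * x.1 + (c2 * x.2 + (c3 * x.1 ^+ 2
    + (c4 * (x.1 * x.2) + (c5 * x.2 ^+ 2 + 0))))); last first.
    by apply: funext => x; rewrite hp; ring.
  by do 5 (eexists; eexists; last reflexivity).
have lq gs q : (forall i, quadratic (nth (fun=> 0) gs i)) -> lspan gs q -> quadratic q.
  elim: gs q => [|g gs ih] q qgs /=; first by move=> ->; exact: quadratic_cst.
  move=> [c [q' sq ->]]; apply: quadratic_lin; first exact: (qgs 0%N).
  by apply: ih => // i; exact: (qgs i.+1).
by apply: lq; exact: monomials_quadratic.
Qed.

(** The projection is chosen among the functions with the defining property;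
    Gram-Schmidt shows that there is one. *)
Lemma proj2P : quadratic (proj2 K f) /\ forall q, quadratic q ->
  L2ip (otri K) (fun x => f x - proj2 K f x) q = 0.
Proof.
have mK := measurable_otri aK.
have [|p sp hp] := @lspan_proj _ (otri K) monomials f mK _ Lf.
  by move=> i _; apply: quadratic_L2_otri => //; exact: monomials_quadratic.
apply: (@xgetPex _ (fun=> 0) [set p | quadratic p /\ forall q, quadratic q ->
    L2ip (otri K) (fun x => f x - p x) q = 0]).
exists p; split; first exact/quadratic_lspan.
by move=> q /quadratic_lspan; exact: hp.
Qed.

Lemma proj2_le q : quadratic q ->
  L2ip (otri K) (fun x => f x - proj2 K f x) (fun x => f x - proj2 K f x)
  <= L2ip (otri K) (fun x => f x - q x) (fun x => f x - q x).
Proof.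
move=> qq; have [qp hp] := proj2P; have mK := measurable_otri aK.
pose r x := f x - proj2 K f x; pose d x := -1 * q x + proj2 K f x.
have qd : quadratic d by exact: quadratic_lin.
have Ld : L2 (otri K) d by exact: quadratic_L2_otri.
have Lr : L2 (otri K) r by apply: L2B => //; exact: quadratic_L2_otri.
have -> : (fun x => f x - q x) = (fun x => 1 * r x + d x).
  by apply: funext => x; rewrite /r/d; ring.
have Lrd : L2 (otri K) (fun x => 1 * r x + d x) by apply: L2D => //; exact: L2Z.
have rd : L2ip (otri K) r d = 0 by exact: hp.
have E k : L2 (otri K) k -> L2ip (otri K) k (fun x => 1 * r x + d x)
    = L2ip (otri K) r k + L2ip (otri K) d k.
  by move=> Lk; rewrite L2ipC L2ip_lin// mul1r.
rewrite [leRHS]L2ip_lin// mul1r !E// (L2ipC _ d r) rd addr0 add0r.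
by rewrite lerDl; exact: L2ip_ge0.
Qed.

End projection.
End piecewise.

(** * One refinement step *)

Section estimates.
Variables (R : realType) (n : nat) (P : ocp R n).
Hypothesis hP : ocp_ok P.
Local Notation Om := (Omega P).
Implicit Types (K : tri R) (T : seq (tri R)) (s : sol R n (pwfun R)).

Lemma measurable_Omega : measurable (Om : set (mpt R)).
Proof. by case: hP => -[[oOm _ _ _] _ _] _ _ _ _; exact: open_measurable_pt. Qed.

Lemma boxed_Omega : boxed Om.
Proof. by case: hP => -[[_ _ _ bOm] _ _] _ _ _ _; exact: bounded_boxed. Qed.

Lemma otri_Omega T K : triangulation Om T -> K \in T -> otri K `<=` Om.
Proof. by case: hP => -[[oOm _ _ _] _ lip] _ _ _ _; exact: otri_subset. Qed.

Lemma area_gt0 T K : triangulation Om T -> K \in T -> 0 < area K.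
Proof. by move=> [_ aT _ _]; exact: aT. Qed.

Definition resid s K (x : pt R) : R := state s K x - yd P x.

Definition osc_resid s K (x : pt R) : R := resid s K x - proj2 K (resid s K) x.

Lemma yd_L2 T K : triangulation Om T -> K \in T -> L2 (otri K) (yd P).
Proof.
move=> tT KT; have [_ _ _ Lyd _] := hP.
apply: L2S Lyd; [exact: measurable_otri (area_gt0 tT KT)|exact: measurable_Omega|].
exact: otri_Omega tT KT.
Qed.

Lemma resid_L2 T s K : triangulation Om T -> morley Om T (state s) -> K \in T ->
  L2 (otri K) (resid s K).
Proof.
move=> tT [qs _ _ _] KT; have aK := area_gt0 tT KT.
apply: L2B; [exact: measurable_otri| |exact: yd_L2 tT KT].
exact/quadratic_L2_otri/qs.
Qed.

Lemma osc_resid_L2 T s K : triangulation Om T -> morley Om T (state s) -> K \in T ->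
  L2 (otri K) (osc_resid s K).
Proof.
move=> tT ms KT; have aK := area_gt0 tT KT; have Lr := resid_L2 tT ms KT.
apply: L2B => //; first exact: measurable_otri.
by apply: quadratic_L2_otri => //; exact: (proj2P aK Lr).1.
Qed.

Lemma vol2E T s : vol2 P T s = wsum T (resid s).
Proof. by apply: eq_bigr => K _; rewrite L2norm_sq. Qed.

Lemma osc_sq T s : triangulation Om T -> morley Om T (state s) ->
  osc P T s ^+ 2 = wsum T (osc_resid s).
Proof.
move=> tT ms; rewrite /osc sqr_sqrtr; last by apply: sumr_ge0 => K _; rewrite sqr_ge0.
rewrite /wsum big_seq [RHS]big_seq; apply: eq_bigr => K KT.
have mK := measurable_otri (area_gt0 tT KT); have Lr := osc_resid_L2 tT ms KT.
rewrite L2norm_sq /L2ip -RintegralZl//; last exact: L2_integrableM.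
by apply: eq_Rintegral => x _; rewrite /osc_resid /resid; ring.
Qed.

Lemma osc_le_vol2 T s : triangulation Om T -> morley Om T (state s) ->
  osc P T s ^+ 2 <= vol2 P T s.
Proof.
move=> tT ms; rewrite osc_sq// vol2E /wsum big_seq [leRHS]big_seq.
apply: ler_sum => K KT; rewrite ler_wpM2l ?hT4_ge0//.
have := proj2_le (area_gt0 tT KT) (resid_L2 tT ms KT) (quadratic_cst 0).
move=> /le_trans; apply; rewrite le_eqVlt; apply/orP; left; apply/eqP.
by apply: eq_L2ip => x _; rewrite subr0.
Qed.

(** On a child K' of K compare the best approximation of the new residual with
    the quadratic polynomial that differs from the new state by the old
    projection error of K. The states cancel, so the difference is exactly that
    projection error. *)
Lemma osc_refine T T' s s' : triangulation Om T -> triangulation Om T' ->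
  morley Om T (state s) -> morley Om T' (state s') -> refinement T T' ->
  osc P T' s' ^+ 2 <= osc P T s ^+ 2.
Proof.
move=> tT tT' ms ms' ref. rewrite [leLHS](osc_sq tT' ms') [leRHS](osc_sq tT ms).
apply: (@le_trans _ _ (wsum T (osc_resid s)
    - 3 / 4 * wsum [seq K <- T | K \notin T'] (osc_resid s))); last first.
  by rewrite gerBl mulr_ge0// wsum_ge0.
apply: (refinement_wsum ref) => [K|K|].
- exact: area_gt0.
- exact: osc_resid_L2.
move=> K K' KT K'T' aK' KK'; have aK := area_gt0 tT KT.
have [qs _ _ _] := ms; have [qs' _ _ _] := ms'.
have [qp _] := proj2P aK (resid_L2 tT ms KT).
pose q x := -1 * (-1 * proj2 K (resid s K) x + state s K x) + state s' K' x.
have qq : quadratic q.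
  by apply: quadratic_lin; [apply: quadratic_lin => //; exact: qs|exact: qs'].
apply: (le_trans (proj2_le aK' (resid_L2 tT' ms' K'T') qq)).
rewrite le_eqVlt; apply/orP; left; apply/eqP.
by apply: eq_L2ip => x _; rewrite /osc_resid /resid /q; ring.
Qed.

Lemma jump_hess2_ge0 T v K E : 0 <= jump_hess2 T v K E.
Proof.
rewrite /jump_hess2 /edge_int mulr_ge0 ?sqrtr_ge0//.
by apply: Rintegral_ge0 => x _; apply: sumr_ge0 => i _; rewrite sqr_ge0.
Qed.

Lemma vol2_le_eta2 T s : vol2 P T s <= eta2 P T s.
Proof.
apply: ler_sum => K _; rewrite lerDl; apply: sumr_ge0 => E _.
by rewrite mulr_ge0 ?sqrtr_ge0// addr_ge0// jump_hess2_ge0.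
Qed.

Lemma vol2_ge0 T s : 0 <= vol2 P T s.
Proof. by rewrite vol2E wsum_ge0. Qed.

Lemma wsum_le_L2 delta T (h : pt R -> R) : triangulation Om T ->
  (forall K, K \in T -> hT K <= delta) -> L2 Om h ->
  wsum T (fun=> h) <= delta ^+ 4 * L2ip Om h h.
Proof.
move=> tT hd Lh; have [uT _ _ _] := tT.
apply: (@le_trans _ _ (delta ^+ 4 * \sum_(K <- T) L2ip (otri K) h h)).
  rewrite mulr_sumr /wsum big_seq [leRHS]big_seq; apply: ler_sum => K KT.
  by rewrite ler_wpM2r ?L2ip_ge0// lerXn2r ?nnegrE ?(le_trans _ (hd K KT)) ?sqrtr_ge0// hd.
rewrite ler_wpM2l ?exprn_even_ge0//.
apply: sum_L2ip_le => //.
- exact: measurable_Omega.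
- by move=> K KT; apply: measurable_otri; exact: (area_gt0 tT).
- by move=> K; exact: (otri_Omega tT).
- by move=> K K'; exact: (triangulation_disjoint tT).
Qed.

(** Extending the residual of T to all of Omega, its weighted norm on T' is
    reduced by bisection ([refinement_wsum]). The residual of T' differs from
    it by the increment of the states, whose L2 norm the discrete embedding
    bounds; h_T <= delta supplies the factor delta^4. *)
Lemma vol2_refine kappa delta C lam T T' s s' : 0 < C -> 0 < lam ->
  discrete_embedding Om kappa C -> TT Om kappa delta T -> TT Om kappa delta T' ->
  morley Om T (state s) -> morley Om T' (state s') -> refinement T T' ->
  vol2 P T' s' <=
    (1 + lam) * (vol2 P T s - 3 / 4 * vol2 P [seq K <- T | K \notin T'] s)
    + (1 + lam^-1) * (C ^+ 2 * delta ^+ 4)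
      * Dnorm 2 Om (pw T' (state s') - pw T (state s)) ^+ 2.
Proof.
move=> C0 l0 emb TT1 TT2 ms ms' ref.
have [tT _ _] := TT1; have [tT' _ hd'] := TT2.
have [qs _ _ _] := ms; have [qs' _ _ _] := ms'.
pose w := (pw T' (state s') - pw T (state s)) [::].
pose g (x : pt R) := pw T (state s) [::] x - yd P x.
have Lpw T0 v : triangulation Om T0 -> (forall K, K \in T0 -> quadratic (v K)) ->
    L2 Om (pw T0 v [::]).
  by move=> t0 q0; apply: (pw_L2 _ t0 q0); [exact: measurable_Omega|exact: boxed_Omega].
have Lw : L2 Om w by apply: L2B; [exact: measurable_Omega|exact: Lpw..].
have Lg : L2 Om g.
  by have [_ _ _ Lyd _] := hP; apply: L2B => //; [exact: measurable_Omega|exact: Lpw].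
have wE : wsum T' (fun=> w) <= C ^+ 2 * delta ^+ 4 *
    Dnorm 2 Om (pw T' (state s') - pw T (state s)) ^+ 2.
  apply: (le_trans (wsum_le_L2 tT' hd' Lw)).
  have := discrete_embedding_L2 C0 emb TT1 TT2 ref ms ms'.
  set D := Dnorm _ _ _ => h.
  have -> : C ^+ 2 * delta ^+ 4 * D ^+ 2 = delta ^+ 4 * (C * D) ^+ 2 by ring.
  rewrite ler_wpM2l ?exprn_even_ge0// -L2norm_sq.
  by rewrite lerXn2r ?nnegrE ?sqrtr_ge0// mulr_ge0 ?sqrtr_ge0// ltW.
have gE : wsum T' (fun=> g) <=
    vol2 P T s - 3 / 4 * vol2 P [seq K <- T | K \notin T'] s.
  rewrite !vol2E; apply: (refinement_wsum ref) => [K|K|].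
  - exact: area_gt0.
  - exact: resid_L2.
  move=> K K' KT K'T' aK' KK'; rewrite le_eqVlt; apply/orP; left; apply/eqP.
  by apply: eq_L2ip => x /KK' xK; rewrite /g /resid (pw_otri _ _ tT KT xK).
have il0 : 0 <= 1 + lam^-1 by rewrite addr_ge0// invr_ge0 ltW.
have l1 : 0 <= 1 + lam by rewrite addr_ge0// ltW.
rewrite -[X in _ <= _ + X]mulrA; apply: (@le_trans _ _ ((1 + lam) * wsum T' (fun=> g)
    + (1 + lam^-1) * wsum T' (fun=> w))); last first.
  by apply: lerD; rewrite ler_wpM2l.
rewrite vol2E /wsum !mulr_sumr -big_split/= big_seq [leRHS]big_seq.
apply: ler_sum => K KT; have aK := area_gt0 tT' KT; have mK := measurable_otri aK.
rewrite !(mulrCA _ (hT K ^+ 4)) -mulrDr ler_wpM2l ?hT4_ge0//.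
have LwK : L2 (otri K) w.
  by apply: L2S Lw; [|exact: measurable_Omega|exact: otri_Omega tT' KT].
have LgK : L2 (otri K) g.
  by apply: L2S Lg; [|exact: measurable_Omega|exact: otri_Omega tT' KT].
have -> : L2ip (otri K) (resid s' K) (resid s' K)
    = L2ip (otri K) (fun x => 1 * g x + w x) (fun x => 1 * g x + w x).
  have e x : otri K x -> resid s' K x = 1 * g x + w x.
    move=> xK; rewrite /resid /g /w.
    rewrite -[(_ - _) [::] x]/(pw T' (state s') [::] x - pw T (state s) [::] x).
    by rewrite (pw_otri _ _ tT' KT xK)/=; ring.
  exact: eq_L2ip.
have sq x : (1 * g x + w x) * (1 * g x + w x) <= (1 + lam) * (g x * g x) + (1 + lam^-1) * (w x * w x).
  have : 0 <= lam * (g x - lam^-1 * w x) ^+ 2 by rewrite mulr_ge0 ?sqr_ge0 ?ltW.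
  have -> : lam * (g x - lam^-1 * w x) ^+ 2 = lam * (g x * g x) - 2 * (g x * w x) + lam^-1 * (w x * w x).
    by field; rewrite gt_eqF.
  nra.
have Lgw : L2 (otri K) (fun x => 1 * g x + w x) by apply: L2D => //; exact: L2Z.
have ig := L2_integrableM mK LgK LgK; have iw := L2_integrableM mK LwK LwK.
have iZ (c : R) k : (lebesgue2 R).-integrable (otri K) (EFin \o k) ->
    (lebesgue2 R).-integrable (otri K) (EFin \o (fun x => c * k x)).
  by move=> ik; exact: (integrableZl mK c ik).
have igw := integrableD mK (iZ (1 + lam) _ ig) (iZ (1 + lam^-1) _ iw).
rewrite /L2ip -(RintegralZl _ mK ig) -(RintegralZl _ mK iw).
rewrite -(RintegralD mK (iZ _ _ ig) (iZ _ _ iw)).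
by apply: le_Rintegral => //; exact: L2_integrableM.
Qed.

(** The common reference point of the three polarisations is the continuous
    solution, so that the squared errors telescope. *)
Lemma dist2_polar T T' s s' (sbar : sol R n (jet R)) :
  triangulation Om T -> triangulation Om T' ->
  morley Om T (state s) -> morley Om T' (state s') ->
  morley Om T (costate s) -> morley Om T' (costate s') ->
  H20 Om (state sbar) -> H20 Om (costate sbar) ->
  dist2 P (pwsol T s) (pwsol T' s') = err2 P sbar T s - err2 P sbar T' s'
   + 2 * (\sum_z (ctrl s' z - ctrl s z) * (ctrl s' z - ctrl sbar z)
     + Dip 2 Om (pw T' (state s') - pw T (state s)) (pw T' (state s') - state sbar)
     + Dip 2 Om (pw T' (costate s') - pw T (costate s))
                (pw T' (costate s') - costate sbar)).
Proof.
move=> tT tT' [qy _ _ _] [qy' _ _ _] [qp _ _ _] [qp' _ _ _].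
move=> [_ _ Ly _] [_ _ Lp _].
have L T0 v : triangulation Om T0 -> (forall K, K \in T0 -> quadratic (v K)) ->
    forall w, L2 Om (pw T0 v w).
  by move=> t0 q0 w; apply: (pw_L2 _ t0 q0); [exact: measurable_Omega|exact: boxed_Omega].
rewrite /err2 /dist2 /=.
rewrite (@Dip_polar _ 2 Om (pw T' (state s')) (pw T (state s)) (state sbar)) //; first last.
- by move=> w w2; apply: Ly; rewrite w2.
- by move=> w _; exact: L.
- by move=> w _; exact: L.
- exact: measurable_Omega.
rewrite (@Dip_polar _ 2 Om (pw T' (costate s')) (pw T (costate s)) (costate sbar)) //; first last.
- by move=> w w2; apply: Lp; rewrite w2.
- by move=> w _; exact: L.
- by move=> w _; exact: L.
- exact: measurable_Omega.
have -> : \sum_z (ctrl s' z - ctrl s z) ^+ 2 =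
    \sum_z (ctrl sbar z - ctrl s z) ^+ 2 - \sum_z (ctrl sbar z - ctrl s' z) ^+ 2
    + 2 * \sum_z (ctrl s' z - ctrl s z) * (ctrl s' z - ctrl sbar z).
  rewrite mulr_sumr -sumrB -big_split/=; apply: eq_bigr => z _; ring.
ring.
Qed.

End estimates.

(** * Absorption of the mixed terms *)

Section arithmetic.
Variable R : realType.

(** With a = 13/20, c = 15/2 and b the coefficient of y^2, this is the weighted
    Cauchy-Schwarz inequality, which requires 4/a + 1/b + 16/c <= 32/3; the
    left-hand side is about 10.39. The numbers subtracted in b bound the loss
    (10 L / eps) (1 + 1/lam) CPI^2 delta^4 in [step_bound]. *)
Lemma quadratic_form_bound (p y x : R) :
  3 / 32 * (2 * p + y + 4 * x) ^+ 2 <=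
  13 / 20 * p ^+ 2 + (13 / 20 - 10 / 192 - 1000 / 8192) * y ^+ 2 + 15 / 2 * x ^+ 2.
Proof.
pose b : R := 13 / 20 - 10 / 192 - 1000 / 8192.
have h1 := sqr_ge0 (13 / 20 * p - 2 * b * y).
have h2 := sqr_ge0 (15 / 2 * x * 2 - 4 * (13 / 20) * p).
have h3 := sqr_ge0 (15 / 2 * x - 4 * b * y).
rewrite /b in h1 h2 h3.
nra.
Qed.

Lemma young2 (a b k : R) : 0 < k -> 2 * (a * b) <= k * b ^+ 2 + k^-1 * a ^+ 2.
Proof.
move=> k0; have : 0 <= k * (b - k^-1 * a) ^+ 2 by rewrite mulr_ge0 ?sqr_ge0// ltW.
have -> : k * (b - k^-1 * a) ^+ 2 = k * b ^+ 2 - 2 * (a * b) + k^-1 * a ^+ 2.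
  by field; rewrite gt_eqF.
lra.
Qed.

(** The variable a stands for CPI^2 delta^4, and m' enters only through the
    reduction property, whose parameter lam is chosen here. *)
Lemma step_bound (C D S L eps a d E E' o m m' r p y : R) :
  0 < C -> 0 <= D -> 1 <= S -> L = 8 * C ^+ 2 * S -> 0 < eps ->
  16 * L * D ^+ 2 <= eps -> 192 * L * a <= eps -> 8192 * L ^+ 2 * a <= eps ^+ 3 ->
  0 <= E' -> 0 <= m -> 0 <= r -> 0 <= p -> 0 <= y ->
  p ^+ 2 + y ^+ 2 <= d ->
  d <= E - E' + 2 * (C * (D * (2 * p + y) + Num.sqrt r) * (Num.sqrt E' + o)) ->
  (forall lam, 0 < lam -> m' <= (1 + lam) * (m - 3 / 4 * r) + (1 + lam^-1) * a * y ^+ 2) ->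
  7 / 20 * d <= (1 - eps / (8 * S)) * (E - E') + 10 * L / eps * (m - m')
    + eps / (8 * S) * E + eps / (4 * S) * o ^+ 2 + eps / 10 * m.
Proof.
move=> C0 D0 S1 LE e0 c1 c2 c3 E0 m0 r0 p0 y0 dpy hd hm.
have S0 : 0 < S by lra.
have L0 : 0 < L by rewrite LE !mulr_gt0// exprn_gt0.
pose A := C * (D * (2 * p + y) + Num.sqrt r).
pose k := eps / (8 * S); pose nu := eps / (4 * S).
have k0 : 0 < k by rewrite divr_gt0// mulr_gt0.
have nu0 : 0 < nu by rewrite divr_gt0// mulr_gt0.
have y1 := young2 A (Num.sqrt E') k0; have y2 := young2 A o nu0.
rewrite sqr_sqrtr// in y1.
have kn : k^-1 * A ^+ 2 + nu^-1 * A ^+ 2 = 12 * S / eps * A ^+ 2.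
  by rewrite /k /nu; field; rewrite !gt_eqF.
pose q := Num.sqrt (eps / (128 * S)).
have q2 : q ^+ 2 = eps / (128 * S) by rewrite sqr_sqrtr// divr_ge0 ?mulr_ge0// ltW.
have q0 : 0 <= q by exact: sqrtr_ge0.
pose x := Num.sqrt (r * L / eps).
have x2 : x ^+ 2 = r * L / eps by rewrite sqr_sqrtr// divr_ge0 ?mulr_ge0// ltW.
have x0 : 0 <= x by exact: sqrtr_ge0.
(* from the first mesh-size bound 16 L D^2 <= eps, as L = 8 C^2 S *)
have CD : C * D <= q.
  rewrite -(@ler_sqr _ (C * D)) ?nnegrE ?mulr_ge0 ?(ltW C0)// q2 ler_pdivlMr ?mulr_gt0//.
  by move: c1; rewrite LE; nra.
have Cr : C * Num.sqrt r = q * (4 * x).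
  apply/eqP; rewrite -(@eqrXn2 _ 2) ?mulr_ge0 ?sqrtr_ge0 ?(ltW C0)//; apply/eqP.
  by rewrite !exprMn q2 x2 sqr_sqrtr// LE; field; rewrite !gt_eqF.
have Aq : A <= q * (2 * p + y + 4 * x).
  by rewrite /A mulrDr Cr mulrA [leRHS]mulrDr lerD2r ler_wpM2r// addr_ge0 ?mulr_ge0.
have A0 : 0 <= A.
  by rewrite mulr_ge0 ?(ltW C0)// addr_ge0 ?sqrtr_ge0// mulr_ge0// addr_ge0 ?mulr_ge0.
have A2 : 12 * S / eps * A ^+ 2 <= 3 / 32 * (2 * p + y + 4 * x) ^+ 2.
  have -> : 3 / 32 * (2 * p + y + 4 * x) ^+ 2
      = 12 * S / eps * (q * (2 * p + y + 4 * x)) ^+ 2.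
    by rewrite exprMn q2; field; rewrite !gt_eqF.
  apply: ler_wpM2l; first by rewrite divr_ge0 ?mulr_ge0// ltW.
  by rewrite lerXn2r ?nnegrE// mulr_ge0// !addr_ge0 ?mulr_ge0.
(* chosen so that the weight W below turns lam into eps / 10 *)
pose lam := eps ^+ 2 / (100 * L).
have lam0 : 0 < lam by rewrite divr_gt0 ?exprn_gt0 ?mulr_gt0.
pose W := 10 * L / eps; have W0 : 0 < W by rewrite divr_gt0 ?mulr_gt0.
have Wl : W * lam = eps / 10 by rewrite /W /lam; field; rewrite !gt_eqF.
have Wx : W * r = 10 * x ^+ 2 by rewrite x2 /W; field; rewrite gt_eqF.
have Wa : W * ((1 + lam^-1) * a) <= 10 / 192 + 1000 / 8192.
  have -> : W * ((1 + lam^-1) * a) = 10 / 192 * ((192 * L * a) / eps)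
     + 1000 / 8192 * ((8192 * L ^+ 2 * a) / eps ^+ 3).
    by rewrite /W /lam; field; rewrite !gt_eqF.
  have t1 : 192 * L * a / eps <= 1 by rewrite ler_pdivrMr// mul1r.
  have t2 : 8192 * L ^+ 2 * a / eps ^+ 3 <= 1 by rewrite ler_pdivrMr ?exprn_gt0// mul1r.
  lra.
have Wm : W * m' <= (W + eps / 10) * m - 3 / 4 * (W * r)
    + (10 / 192 + 1000 / 8192) * y ^+ 2.
  apply: (le_trans (ler_wpM2l (ltW W0) (hm lam lam0))).
  have -> : W * ((1 + lam) * (m - 3 / 4 * r) + (1 + lam^-1) * a * y ^+ 2) =
    (W + W * lam) * m - 3 / 4 * (W * r) - 3 / 4 * (W * lam * r)
     + W * ((1 + lam^-1) * a) * y ^+ 2 by ring.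
  rewrite Wl; have := ler_wpM2r (sqr_ge0 y) Wa.
  have : 0 <= eps / 10 * r by rewrite mulr_ge0 ?divr_ge0// ltW.
  lra.
have qf := quadratic_form_bound p y x.
rewrite -/k -/nu -/W.
have hdA : d <= E - E' + 2 * (A * Num.sqrt E') + 2 * (A * o).
  by apply: (le_trans hd); rewrite -/A; lra.
lra.
Qed.

Lemma sum_three_bounds (Cc Cs Ca D p y q e : R) (C := Num.max Cc (Num.max Cs Ca)) :
  0 <= D -> 0 <= p -> 0 <= y -> 0 <= q -> 0 <= e ->
  Cc * D * p * e + Cs * D * p * e + Ca * (q + D * y) * e
  <= C * (D * (2 * p + y) + q) * e.
Proof.
move=> D0 p0 y0 q0 e0; rewrite -!mulrDl ler_wpM2r//.
have h (c u : R) : c <= C -> 0 <= u -> c * u <= C * u by move=> cC u0; rewrite ler_wpM2r.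
have w1 := h Cc (D * p) ltac:(by rewrite le_max lexx) ltac:(by rewrite mulr_ge0).
have w2 := h Cs (D * p) ltac:(by rewrite !le_max lexx orbT) ltac:(by rewrite mulr_ge0).
have w3 := h Ca (q + D * y) ltac:(by rewrite !le_max lexx !orbT)
  ltac:(by rewrite addr_ge0 ?mulr_ge0).
move: (C) w1 w2 w3 => C'; lra.
Qed.

(** The error and oscillation terms cost
    (R2 / 8 + 1 / 4) / S <= 1/4 times eps H, the volume term eps / 10 times H. *)
Lemma potential_step (S R2 L eps d E E' o m m' H : R) :
  S = 1 + R2 -> 0 <= R2 -> 0 < eps -> E <= R2 * H -> m <= H -> o ^+ 2 <= H -> 0 <= H ->
  7 / 20 * d <= (1 - eps / (8 * S)) * (E - E') + 10 * L / eps * (m - m')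
    + eps / (8 * S) * E + eps / (4 * S) * o ^+ 2 + eps / 10 * m ->
  7 / 20 * d <= ((1 - eps / (8 * S)) * E + 10 * L / eps * m)
    - ((1 - eps / (8 * S)) * E' + 10 * L / eps * m') + 7 / 20 * (eps * H).
Proof.
move=> SE R0 e0 EH mH oH H0 hd; have S0 : 0 < S by lra.
have q1 : eps / (8 * S) * E <= eps / (8 * S) * (R2 * H).
  by rewrite ler_wpM2l// ltW// divr_gt0// mulr_gt0.
have q2 : eps / (4 * S) * o ^+ 2 <= eps / (4 * S) * H.
  by rewrite ler_wpM2l// ltW// divr_gt0// mulr_gt0.
have q3 : eps / 10 * m <= eps / 10 * H by rewrite ler_wpM2l// ltW// divr_gt0.
have q4 : eps / (8 * S) * (R2 * H) + eps / (4 * S) * H <= 1 / 4 * (eps * H).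
  have -> : eps / (8 * S) * (R2 * H) + eps / (4 * S) * H =
    (R2 / 8 + 1 / 4) / S * (eps * H) by field; rewrite gt_eqF.
  by rewrite ler_wpM2r ?mulr_ge0 ?(ltW e0)// ler_pdivrMr//; lra.
lra.
Qed.

Lemma potential_sum (Phi d H : nat -> R) (c eps : R) (l m : nat) :
  (forall k, 7 / 20 * d k <= Phi k - Phi k.+1 + 7 / 20 * (eps * H k)) ->
  (forall k, 0 <= Phi k) -> (forall k, Phi k <= c * H k) ->
  \sum_(l <= k < (l + m).+1) d k
  <= 20 / 7 * c * H l + eps * \sum_(l <= k < (l + m).+1) H k.
Proof.
move=> step Phi0 PhiH.
have : 7 / 20 * \sum_(l <= k < (l + m).+1) d k <=
    Phi l - Phi (l + m).+1 + 7 / 20 * (eps * \sum_(l <= k < (l + m).+1) H k).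
  have -> : Phi l - Phi (l + m).+1 = \sum_(l <= k < (l + m).+1) (Phi k - Phi k.+1).
    rewrite -opprB -telescope_sumr; last by rewrite ltnW// ltnS leq_addr.
    by rewrite -sumrN; apply: eq_bigr => k _; rewrite opprB.
  by rewrite !mulr_sumr -big_split/=; apply: ler_sum => k _; exact: step.
have := Phi0 (l + m).+1; have := PhiH l; lra.
Qed.

(** Fractional powers disappear when the third bound is cubed. *)
Lemma meshsize_condP (gamma L0 L6 eps delta : R) :
  0 <= L0 -> 0 <= L6 -> 0 < delta -> meshsize_cond gamma L0 L6 eps delta ->
  [/\ 16 * L6 ^+ 2 * (delta `^ (2 - gamma)) ^+ 2 <= eps,
      192 * L6 ^+ 2 * (L0 ^+ 2 * delta ^+ 4) <= eps
    & 8192 * (L6 ^+ 2) ^+ 2 * (L0 ^+ 2 * delta ^+ 4) <= eps ^+ 3].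
Proof.
move=> l0 l6 d0; rewrite /meshsize_cond !ge_max => /and3P[h1 h2 h3].
have cube (z u : R) (k : nat) : 0 <= z -> u * 3 = k%:R -> (z `^ u) ^+ 3 = z ^+ k.
  by move=> z0 uk; rewrite -powR_mulrn ?powR_ge0// -powRrM uk powR_mulrn.
split.
- move: h1; rewrite mulrC [2 * _]mulrC powRrM -[(_ `^ 2)]/(_ `^ 2%:R) powR_mulrn ?powR_ge0//.
  lra.
- lra.
apply: le_trans (_ : _ <= (2 `^ (13 / 3) * L6 `^ (4 / 3) * L0 `^ (2 / 3) * delta `^ (4 / 3)) ^+ 3) _.
  have e1 : (2 `^ (13 / 3) : R) ^+ 3 = 2 ^+ 13 by apply: cube => //; lra.
  have e2 : (L6 `^ (4 / 3)) ^+ 3 = L6 ^+ 4 by apply: cube => //; lra.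
  have e3 : (L0 `^ (2 / 3)) ^+ 3 = L0 ^+ 2 by apply: cube => //; lra.
  have e4 : (delta `^ (4 / 3)) ^+ 3 = delta ^+ 4 by apply: cube; [exact: ltW|lra].
  rewrite !exprMn e1 e2 e3 e4 le_eqVlt; apply/orP; left; apply/eqP; ring.
by rewrite lerXn2r// nnegrE ?(le_trans _ h3)// !mulr_ge0 ?powR_ge0.
Qed.

End arithmetic.

(** * The sum over the refinement steps *)

Lemma Csa_sq (R : realType) (Cc Cs Ca : R) :
  Csa Cc Cs Ca ^+ 2 = 8 * Num.max Cc (Num.max Cs Ca) ^+ 2.
Proof.
rewrite /Csa exprMn; congr (_ * _).
by rewrite -powR_mulrn ?powR_ge0// -powRrM (_ : 3 / 2 * 2%:R = 3%:R) ?powR_mulrn//; [ring|field].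
Qed.

(** Bisection keeps the vertices of a triangle, so the point sources stay at
    interior vertices on every level. *)
Lemma solved_seq (R : realType) (n : nat) (P : ocp R n) (kappa delta : R)
    (T : nat -> seq (tri R)) (J : nat -> pwfun R -> jet R)
    (s : nat -> sol R n (pwfun R)) :
  (forall z, interior_vertex (Omega P) (T 0%N) (Zpt P z)) ->
  (forall l, TT (Omega P) kappa delta (T l)) ->
  (forall l, refinement (T l) (T l.+1)) ->
  (forall l, companion (Omega P) (T l) (J l)) ->
  (forall l, discrete_solution P (T l) (J l) (s l)) ->
  forall l, solved P kappa delta (T l) (s l).
Proof.
move=> zT TTT ref cJ dJ l; split=> //; last by exists (J l).
move=> z; elim: l => // l [Oz [K KT zK]]; split=> //.
by have [K' K'T zK'] := refinement_vertex (ref l) KT zK; exists K'.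
Qed.

Theorem theorem4p6 (R : realType) (n : nat) (P : ocp R n)
    (sigma gamma kappa : R) (sbar : sol R n (jet R))
    (CREL CPI Cc Cs Ca : R)
    (hP : ocp_ok P)
    (hsigma : 0 < sigma <= 1)
    (hreg : elliptic_regularity (Omega P) sigma)
    (hgamma : 2 - sigma < gamma <= 2)
    (hsbar : continuous_solution P sbar)
    (hCREL : 0 < CREL) (hrel : reliability P kappa sbar CREL)
    (hCPI : 0 < CPI) (hPI : discrete_embedding (Omega P) kappa CPI)
    (hCc : 0 < Cc) (hc : control_bound P kappa gamma sbar Cc)
    (hCs : 0 < Cs) (hs : state_bound P kappa gamma sbar Cs)
    (hCa : 0 < Ca) (ha : costate_bound P kappa gamma sbar Ca)
    (eps delta2 : R)
    (L0 := CPI) (L6 := Lambda6 CREL Cc Cs Ca)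
    (heps : 0 < eps <= eps0 CREL L6)
    (hdelta2 : 0 < delta2 /\ meshsize_cond gamma L0 L6 eps delta2)
    (hmax : forall delta, 0 < delta -> meshsize_cond gamma L0 L6 eps delta ->
       delta <= delta2) :
  exists delta Lambda4 : R,
    [/\ 0 < delta <= delta2,
        meshsize_cond gamma L0 L6 eps delta,
        0 < Lambda4
      & forall (T : nat -> seq (tri R)) (J : nat -> pwfun R -> jet R)
          (s : nat -> sol R n (pwfun R)),
        (forall z, interior_vertex (Omega P) (T 0%N) (Zpt P z)) ->
        (forall l, TT (Omega P) kappa delta2 (T l)) ->
        (forall l, refinement (T l) (T l.+1)) ->
        (forall l, companion (Omega P) (T l) (J l)) ->
        (forall l, discrete_solution P (T l) (J l) (s l)) ->
        forall l m : nat,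
        \sum_(l <= k < (l + m).+1)
           dist2 P (pwsol (T k) (s k)) (pwsol (T k.+1) (s k.+1))
        <= Lambda4 * eta2 P (T l) (s l)
           + eps * \sum_(l <= k < (l + m).+1) eta2 P (T k) (s k)].
Proof.
move: hdelta2 => [d20 hmesh]; move: heps => /andP[e0].
rewrite /eps0 le_min => /andP[e8 _].
pose C := Num.max Cc (Num.max Cs Ca); pose S := 1 + CREL ^+ 2.
pose L := 8 * C ^+ 2 * S; pose D := delta2 `^ (2 - gamma).
pose a := L0 ^+ 2 * delta2 ^+ 4.
have C0 : 0 < C by rewrite lt_max hCc.
have R2 : 0 < CREL ^+ 2 by rewrite exprn_gt0.
have S1 : 1 <= S by rewrite lerDl ltW.
have S0 : 0 < S by exact: lt_le_trans S1.
have e8S : eps <= 8 * S.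
  by rewrite (_ : 8 * S = 2 ^+ 3 * (1 + CREL ^+ 2))//; rewrite /S; ring.
have L60 : 0 <= L6 by exact: sqrtr_ge0.
have L6E : L6 ^+ 2 = L.
  rewrite /L6 /Lambda6 sqr_sqrtr; last by rewrite mulr_ge0 ?sqr_ge0// ltW.
  by rewrite Csa_sq.
have L_gt0 : 0 < L by rewrite !mulr_gt0// exprn_gt0.
have [c1 c2 c3] := meshsize_condP (ltW hCPI) L60 d20 hmesh.
rewrite L6E -/D -/a in c1 c2 c3.
have D0 : 0 <= D by exact: powR_ge0.
have [Hy Hp] : H20 (Omega P) (state sbar) /\ H20 (Omega P) (costate sbar).
  by case: hsbar => -[].
exists delta2, (20 / 7 * (CREL ^+ 2 + 10 * L / eps)); split=> //.
- by rewrite d20 lexx.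
- by rewrite mulr_gt0// addr_gt0// divr_gt0// mulr_gt0.
move=> T J s zT TTT ref cJ dJ l m.
have sol k := solved_seq zT TTT ref cJ dJ k.
have tT k : triangulation (Omega P) (T k) by case: (TTT k).
have [my mp] : (forall k, morley (Omega P) (T k) (state (s k))) /\
    (forall k, morley (Omega P) (T k) (costate (s k))).
  by split=> k; case: (dJ k) => -[].
pose E k := err2 P sbar (T k) (s k); pose V k := vol2 P (T k) (s k).
pose H k := eta2 P (T k) (s k).
pose d k := dist2 P (pwsol (T k) (s k)) (pwsol (T k.+1) (s k.+1)).
have E_ge0 k : 0 <= E k.
  by rewrite /E /err2 /dist2 !addr_ge0 ?sqr_ge0// sumr_ge0// => z _; rewrite sqr_ge0.
have EH k : E k <= CREL ^+ 2 * H k by exact: hrel (sol k).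
have V_ge0 k : 0 <= V k by exact: vol2_ge0.
have VH k : V k <= H k by exact: vol2_le_eta2.
pose Phi k := (1 - eps / (8 * S)) * E k + 10 * L / eps * V k.
have kap1 : 0 <= 1 - eps / (8 * S).
  by rewrite subr_ge0 ler_pdivrMr ?mulr_gt0// mul1r.
have W0 : 0 < 10 * L / eps by rewrite divr_gt0// mulr_gt0.
apply: (@potential_sum R Phi d H) => k; first last.
- rewrite mulrDl; apply: lerD; last by rewrite ler_wpM2l// ltW.
  by apply: le_trans (EH k); rewrite ler_piMl// gerBl divr_ge0 ?mulr_ge0// ltW.
- by rewrite /Phi; apply: addr_ge0; rewrite mulr_ge0// ltW.
- pose p := Dnorm 2 (Omega P) (pw (T k.+1) (costate (s k.+1)) - pw (T k) (costate (s k))).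
  pose y := Dnorm 2 (Omega P) (pw (T k.+1) (state (s k.+1)) - pw (T k) (state (s k))).
  pose r := vol2 P [seq K <- T k | K \notin T k.+1] (s k).
  pose o' := osc P (T k.+1) (s k.+1).
  have pair : solved_pair P kappa delta2 (T k) (T k.+1) (s k) (s k.+1) by split.
  have p0 : 0 <= p by exact: sqrtr_ge0.
  have y0 : 0 <= y by exact: sqrtr_ge0.
  have dpy : p ^+ 2 + y ^+ 2 <= d k.
    rewrite /d /dist2 /= -/p -/y -addrA (addrC (p ^+ 2)) lerDr.
    by apply: sumr_ge0 => z _; rewrite sqr_ge0.
  have ehE : ehat P sbar (T k.+1) (s k.+1) = Num.sqrt (E k.+1) + o' by [].
  have eh0 : 0 <= Num.sqrt (E k.+1) + o' by rewrite addr_ge0 ?sqrtr_ge0.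
  have b1 := hc _ _ _ _ _ d20 pair; have b2 := hs _ _ _ _ _ d20 pair; have b3 := ha _ _ _ _ _ d20 pair.
  rewrite ehE -/p -/y -/r -/D in b1 b2 b3.
  have hd : d k <= E k - E k.+1
      + 2 * (C * (D * (2 * p + y) + Num.sqrt r) * (Num.sqrt (E k.+1) + o')).
    rewrite /d (dist2_polar hP (sbar := sbar)) //.
    rewrite -/(E k) -/(E k.+1) lerD2l ler_wpM2l//.
    apply: (le_trans (lerD (lerD b1 b2) b3)).
    exact: sum_three_bounds.
  have hv lam : 0 < lam -> V k.+1 <= (1 + lam) * (V k - 3 / 4 * r) + (1 + lam^-1) * a * y ^+ 2.
    by move=> l0; exact: (vol2_refine hP hCPI l0 hPI (TTT k) (TTT k.+1) (my k) (my k.+1) (ref k)).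
  apply: (potential_step erefl (ltW R2) e0 (EH k) (VH k) (o := o')).
  - apply: le_trans (VH k).
    apply: le_trans (osc_refine hP (tT k) (tT k.+1) (my k) (my k.+1) (ref k)) _.
    exact: osc_le_vol2.
  - exact: le_trans (V_ge0 k) (VH k).
  exact: (step_bound C0 D0 S1 erefl e0 c1 c2 c3 (E_ge0 k.+1) (V_ge0 k)
    (vol2_ge0 P _ _) p0 y0 dpy hd hv).
Qed.
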